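(* Let $n\ge1$ and let $\Lambda$ be a finite dimensional algebra. Assume $\operatorname{gl.dim}\Lambda\le n$ and that $\Lambda$ has an $n$-cluster tilting object $M$ (in $\operatorname{mod}\Lambda$). Then $\mathcal M=\operatorname{add}M$ holds, where $\mathcal M:=\operatorname{add}\{\tau_n^i(D\Lambda)\mid i\ge0\}$. In particular, $\mathcal M$ is a unique $n$-cluster tilting subcategory of $\operatorname{mod}\Lambda$.
   Context: Conventions: algebras are finite dimensional over a field $k$; modules are finitely generated right modules; $D=\operatorname{Hom}_k(-,k)$; subcategories are full and closed under isomorphism, direct sums and direct summands; $\operatorname{add}$ denotes closure under finite direct sums and direct summands. Since $\operatorname{gl.dim}\Lambda\le n$, $\tau_n$ denotes the functor $D\operatorname{Ext}^n_\Lambda(-,\Lambda):\operatorname{mod}\Lambda\to\operatorname{mod}\Lambda$. A subcategory $\mathcal C$ of $\operatorname{mod}\Lambda$ is $n$-cluster tilting if it is functorially finite and $\mathcal C=\{X\in\operatorname{mod}\Lambda\mid\operatorname{Ext}^i_\Lambda(X,\mathcal C)=0\ (0<i<n)\}=\{X\in\operatorname{mod}\Lambda\mid\operatorname{Ext}^i_\Lambda(\mathcal C,X)=0\ (0<i<n)\}$. An object $C$ is $n$-cluster tilting if $\operatorname{add}C$ is. *)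

(* Defs.v *)
From HB Require Import structures.
From mathcomp Require Import all_boot all_order all_algebra all_field.

Set Implicit Arguments.
Unset Strict Implicit.
Unset Printing Implicit Defensive.

Import GRing.Theory.
Local Open Scope ring_scope.

(** Since [A] is finite dimensional over the field [k], a right [A]-module is
    finitely generated iff it is finite dimensional over [k]; so the objects of
    mod [A] are finite dimensional [k]-spaces with a right action of [A]. *)
Record rmodule (k : fieldType) (A : falgType k) := RModule {
  rsort :> vectType k;
  ract : rsort -> A -> rsort;
  ract_linearl : forall a : A, linear (ract^~ a);
  ract_linearr : forall x : rsort, linear (ract x);
  ract1 : forall x, ract x 1 = x;
  ractM : forall x a b, ract x (a * b) = ract (ract x a) b
}.

Record lmodule (k : fieldType) (A : falgType k) := LModule {
  lsort :> vectType k;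
  lact : A -> lsort -> lsort;
  lact_linearl : forall x : lsort, linear (lact^~ x);
  lact_linearr : forall a : A, linear (lact a);
  lact1 : forall x, lact 1 x = x;
  lactM : forall a b x, lact (a * b) x = lact a (lact b x)
}.

Section LfunComp.
Variables (k : fieldType) (U V W : vectType k).

Definition precomp (g : 'Hom(U, V)) (f : 'Hom(V, W)) : 'Hom(U, W) :=
  (f \o g)%VF.

Fact precomp_is_linear g : linear (precomp g).
Proof. by move=> c f f'; rewrite /precomp comp_lfunDl comp_lfunZl. Qed.

HB.instance Definition _ g :=
  GRing.isSemilinear.Build k 'Hom(V, W) 'Hom(U, W) _ (precomp g)
    (GRing.semilinear_linear (precomp_is_linear g)).

End LfunComp.

Section Quotient.
Variables (k : fieldType) (V : vectType k) (Z B : {vspace V}).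

(** The quotient Z / B (for B <= Z), realized on the complement [Z :\: B] of
    B in Z; see [vquot_eq0] and [vquot_surj]. *)
Definition vquot : vectType k := subvs_of (Z :\: B).

Definition vquot_pi (v : V) : vquot := vsproj (Z :\: B) (addv_pi1 Z B v).

Fact vquot_pi_is_linear : linear vquot_pi.
Proof. by move=> c u v; rewrite /vquot_pi !linearP. Qed.

HB.instance Definition _ :=
  GRing.isSemilinear.Build k V vquot _ vquot_pi
    (GRing.semilinear_linear vquot_pi_is_linear).

Lemma vquot_val (q : vquot) : vsval q \in Z.
Proof. exact: (subvP (diffvSl Z B)) (subvsP q). Qed.

Lemma vquot_piK : cancel vsval vquot_pi.
Proof.
move=> q; rewrite /vquot_pi /addv_pi1 daddv_pi_id ?vsvalK ?subvsP //.
exact: capv_diff.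
Qed.

Lemma vquot_surj (q : vquot) : exists2 z, z \in Z & vquot_pi z = q.
Proof. by exists (vsval q); [exact: vquot_val | exact: vquot_piK]. Qed.

Hypothesis sBZ : (B <= Z)%VS.

Lemma vquot_piB z : z \in Z -> z - vsval (vquot_pi z) \in B.
Proof.
move=> zZ; rewrite /vquot_pi vsprojK; last exact: memv_pi.
have: z \in (Z + B)%VS by rewrite (subvP (addvSl _ _)).
by move=> /addv_pi1_pi2 {1}<-; rewrite addrC addKr memv_pi2.
Qed.

Lemma vquot_eq0 z : z \in Z -> (vquot_pi z == 0) = (z \in B).
Proof.
move=> zZ; apply/eqP/idP => [z0 | zB].
  by have := vquot_piB zZ; rewrite z0 /= subr0.
apply: val_inj; apply/eqP; rewrite /= -memv0 -(capv_diff Z B) memv_cap subvsP.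
by rewrite -(subKr z (vsval _)) memvB // vquot_piB.
Qed.

End Quotient.

Section Modules.
Variables (k : fieldType) (A : falgType k).
Implicit Types M N P X Y Z : rmodule A.

Definition ract_by M (a : A) (x : M) : M := ract x a.

HB.instance Definition _ M a :=
  GRing.isSemilinear.Build k M M _ (@ract_by M a)
    (GRing.semilinear_linear (ract_linearl (r := M) a)).
HB.instance Definition _ M (x : M) :=
  GRing.isSemilinear.Build k A M _ (ract x)
    (GRing.semilinear_linear (ract_linearr x)).
HB.instance Definition _ (M : lmodule A) a :=
  GRing.isSemilinear.Build k M M _ (lact (l := M) a)
    (GRing.semilinear_linear (lact_linearr (l := M) a)).

Definition rlinear M N (f : 'Hom(M, N)) : Prop :=
  forall x a, f (ract x a) = ract (f x) a.

Lemma rlinear_comp M N P (g : 'Hom(N, P)) (f : 'Hom(M, N)) :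
  rlinear g -> rlinear f -> rlinear (g \o f)%VF.
Proof. by move=> gL fL x a; rewrite !comp_lfunE fL gL. Qed.

Definition riso M N : Prop :=
  exists2 f : 'Hom(M, N), rlinear f & bijective f.

Section Hom.
Variables M N : rmodule A.

Definition rdefect (a : A) (f : 'Hom(M, N)) : 'Hom(M, N) :=
  (f \o linfun (@ract_by M a))%VF - (linfun (@ract_by N a) \o f)%VF.

Fact rdefect_is_linear a : linear (rdefect a).
Proof.
move=> c f g; rewrite /rdefect comp_lfunDl comp_lfunDr.
by rewrite -comp_lfunZl -comp_lfunZr opprD addrACA scalerBr.
Qed.

HB.instance Definition _ a :=
  GRing.isSemilinear.Build k 'Hom(M, N) 'Hom(M, N) _ (rdefect a)
    (GRing.semilinear_linear (rdefect_is_linear a)).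

(** Hom_A(M, N) as a subspace of Hom_k(M, N); see [rhomP]. *)
Definition rhom : {vspace 'Hom(M, N)} :=
  (\bigcap_(i < \dim {:A}) lker (linfun (rdefect (vbasis {:A})`_i)))%VS.

Lemma rhomP f : f \in rhom <-> rlinear f.
Proof.
split=> [fH x a | fL]; last first.
  rewrite memvE; apply/subv_bigcapP => i _; rewrite -memvE memv_ker lfunE /=.
  apply/eqP/lfunP => x; rewrite zero_lfunE add_lfunE opp_lfunE !comp_lfunE.
  by rewrite !lfunE /= fL subrr.
rewrite (coord_vbasis (memvf a)) !linear_sum /=; apply: eq_bigr => i _.
rewrite !linearZ /=; congr (_ *: _); apply/eqP; rewrite -subr_eq0; apply/eqP.
move: fH; rewrite memvE => /subv_bigcapP/(_ i isT).
rewrite -memvE memv_ker lfunE /= => /eqP/lfunP/(_ x).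
by rewrite zero_lfunE add_lfunE opp_lfunE !comp_lfunE !lfunE.
Qed.

End Hom.

Section Submodule.
Variables (M : rmodule A) (U : {vspace M}).
Hypothesis stabU : forall x a, x \in U -> ract x a \in U.

Definition rsub_act (u : subvs_of U) (a : A) : subvs_of U :=
  Subvs (stabU a (subvsP u)).

Fact rsub_linearl a : linear (rsub_act^~ a).
Proof. by move=> c u v; apply: val_inj; rewrite /= ract_linearl. Qed.

Fact rsub_linearr u : linear (rsub_act u).
Proof. by move=> c a b; apply: val_inj; rewrite /= ract_linearr. Qed.

Fact rsub_act1 u : rsub_act u 1 = u.
Proof. by apply: val_inj; rewrite /= ract1. Qed.

Fact rsub_actM u a b : rsub_act u (a * b) = rsub_act (rsub_act u a) b.
Proof. by apply: val_inj; rewrite /= ractM. Qed.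

Definition rsub : rmodule A :=
  RModule rsub_linearl rsub_linearr rsub_act1 rsub_actM.

End Submodule.

Section DirectSum.
Variables M N : rmodule A.

Definition dsum_act (x : (M * N)%type) (a : A) : (M * N)%type :=
  (ract x.1 a, ract x.2 a).

Fact dsum_linearl a : linear (dsum_act^~ a).
Proof. by move=> c x y; rewrite /dsum_act /= !ract_linearl. Qed.

Fact dsum_linearr x : linear (dsum_act x).
Proof. by move=> c a b; rewrite /dsum_act /= !ract_linearr. Qed.

Fact dsum_act1 x : dsum_act x 1 = x.
Proof. by case: x => x y; rewrite /dsum_act !ract1. Qed.

Fact dsum_actM x a b : dsum_act x (a * b) = dsum_act (dsum_act x a) b.
Proof. by rewrite /dsum_act !ractM. Qed.

Definition dsum : rmodule A :=
  RModule dsum_linearl dsum_linearr dsum_act1 dsum_actM.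

End DirectSum.

Section Free.
Variable n : nat.

Definition rfree_act (x : {ffun 'I_n -> A}) (a : A) : {ffun 'I_n -> A} :=
  [ffun i => x i * a].

Fact rfree_linearl a : linear (rfree_act^~ a).
Proof. by move=> c x y; apply/ffunP => i; rewrite !ffunE mulrDl scalerAl. Qed.

Fact rfree_linearr x : linear (rfree_act x).
Proof. by move=> c a b; apply/ffunP => i; rewrite !ffunE mulrDr scalerAr. Qed.

Fact rfree_act1 x : rfree_act x 1 = x.
Proof. by apply/ffunP => i; rewrite ffunE mulr1. Qed.

Fact rfree_actM x a b : rfree_act x (a * b) = rfree_act (rfree_act x a) b.
Proof. by apply/ffunP => i; rewrite !ffunE mulrA. Qed.

Definition rfree : rmodule A :=
  RModule rfree_linearl rfree_linearr rfree_act1 rfree_actM.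

End Free.

Definition rzero : rmodule A := rfree 0.

Fact rreg_linearl (a : A) : linear (fun x : A => x * a).
Proof. by move=> c x y; rewrite mulrDl scalerAl. Qed.

Fact rreg_linearr (x : A) : linear (fun a : A => x * a).
Proof. by move=> c a b; rewrite mulrDr scalerAr. Qed.

Definition rreg : rmodule A :=
  RModule rreg_linearl rreg_linearr (@mulr1 A) (@mulrA A).

Definition lreg : lmodule A :=
  LModule rreg_linearl rreg_linearr (@mul1r A)
    (fun a b x => esym (mulrA a b x)).

Section Dual.
Variable M : lmodule A.

Definition dual_act (f : 'Hom(M, k^o)) (a : A) : 'Hom(M, k^o) :=
  (f \o linfun (lact (l := M) a))%VF.

Fact dual_linearl a : linear (dual_act^~ a).
Proof. by move=> c f g; rewrite /dual_act comp_lfunDl comp_lfunZl. Qed.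

Fact dual_linearr f : linear (dual_act f).
Proof.
move=> c a b; apply/lfunP => x.
rewrite add_lfunE scale_lfunE !comp_lfunE !lfunE /=.
by rewrite lact_linearl linearP.
Qed.

Fact dual_act1 f : dual_act f 1 = f.
Proof. by apply/lfunP => x; rewrite comp_lfunE lfunE /= lact1. Qed.

Fact dual_actM f a b : dual_act f (a * b) = dual_act (dual_act f a) b.
Proof. by apply/lfunP => x; rewrite !comp_lfunE !lfunE /= lactM. Qed.

Definition dual : rmodule A :=
  RModule dual_linearl dual_linearr dual_act1 dual_actM.

End Dual.

Definition projective P : Prop :=
  forall M N (g : 'Hom(M, N)) (f : 'Hom(P, N)),
    rlinear g -> rlinear f -> limg g = fullv ->
    exists2 h : 'Hom(P, M), rlinear h & (g \o h)%VF = f.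

Record proj_resolution M := ProjResolution {
  res_obj :> nat -> rmodule A;
  res_d : forall i, 'Hom(res_obj i.+1, res_obj i);
  res_aug : 'Hom(res_obj 0, M);
  res_proj : forall i, projective (res_obj i);
  res_d_rlinear : forall i, rlinear (res_d i);
  res_aug_rlinear : rlinear res_aug;
  res_aug_surj : limg res_aug = fullv;
  res_exact0 : limg (res_d 0) = lker res_aug;
  res_exact : forall i, limg (res_d i.+1) = lker (res_d i)
}.

Definition pdim_le n M : Prop :=
  exists R : proj_resolution M, forall i, (n < i)%N -> forall x : R i, x = 0.

Definition gldim_le n : Prop := forall M, pdim_le n M.

Section FreeCover.
Variable M : rmodule A.

Definition cover : rmodule A := rfree (\dim {:M}).

Definition cover_fun (x : cover) : M :=
  \sum_(i < \dim {:M}) ract (vbasis {:M})`_i (x i).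

Fact cover_fun_is_linear : linear cover_fun.
Proof.
move=> c x y; rewrite /cover_fun scaler_sumr -big_split /=.
by apply: eq_bigr => i _; rewrite !ffunE ract_linearr.
Qed.

HB.instance Definition _ :=
  GRing.isSemilinear.Build k cover M _ cover_fun
    (GRing.semilinear_linear cover_fun_is_linear).

Definition cover_map : 'Hom(cover, M) := linfun cover_fun.

Lemma cover_map_rlinear : rlinear cover_map.
Proof.
move=> x a; rewrite !lfunE /= /cover_fun.
rewrite -[RHS]/(ract_by a _) linear_sum /=.
by apply: eq_bigr => i _; rewrite ffunE ractM.
Qed.

Lemma cover_map_surj : limg cover_map = fullv.
Proof.
apply/eqP; rewrite eqEsubv subvf; apply/subvP => x _.
have -> : x = cover_map [ffun i => (coord (vbasis {:M}) i x)%:A].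
  rewrite lfunE /= /cover_fun {1}(coord_vbasis (memvf x)).
  by apply: eq_bigr => i _; rewrite ffunE linearZ /= ract1.
exact: memv_img (memvf _).
Qed.

Fact cover_ker_stable x a :
  x \in lker cover_map -> ract x a \in lker cover_map.
Proof.
rewrite !memv_ker => /eqP x0.
by rewrite cover_map_rlinear x0 -/(ract_by a 0) linear0.
Qed.

Definition syzygy : rmodule A := rsub cover_ker_stable.

Definition syzygy_incl : 'Hom(syzygy, cover) :=
  linfun (fun u : syzygy => vsval u).

Lemma syzygy_incl_rlinear : rlinear syzygy_incl.
Proof. by move=> u a; rewrite !lfunE. Qed.

Lemma limg_syzygy_incl : limg syzygy_incl = lker cover_map.
Proof.
apply/vspaceP => x; apply/memv_imgP/idP => [[u _ ->] | xK].
  by rewrite lfunE /= subvsP.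
by exists (Subvs xK); rewrite ?memvf // lfunE.
Qed.

Lemma lker_syzygy_incl : lker syzygy_incl = 0%VS.
Proof.
by apply/eqP/lker0P => u v; rewrite !lfunE /= => /val_inj.
Qed.

End FreeCover.

Lemma rfree_projective n : projective (rfree n).
Proof.
move=> M N g f gL fL gS.
pose e i : rfree n := [ffun j => (i == j)%:R].
pose y i : M := (g^-1)%VF (f (e i)).
have gy i : g (y i) = f (e i) by rewrite limg_lfunVK // gS memvf.
pose h (x : rfree n) : M := \sum_i ract (y i) (x i).
have hL : linear h.
  move=> c u v; rewrite /h scaler_sumr -big_split /=.
  by apply: eq_bigr => i _; rewrite !ffunE ract_linearr.
pose hH := GRing.isSemilinear.Build k (rfree n) M _ h
  (GRing.semilinear_linear hL).
pose h' : {linear rfree n -> M} := HB.pack h hH.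
exists (linfun h') => [x a|].
  rewrite !lfunE /= /h -[RHS]/(ract_by a _) linear_sum /=.
  by apply: eq_bigr => i _; rewrite ffunE ractM.
apply/lfunP => x; rewrite comp_lfunE lfunE /= /h linear_sum /=.
have {2}-> : x = \sum_i ract (e i) (x i).
  apply/ffunP => j; rewrite sum_ffunE (bigD1 j) //= !ffunE eqxx mul1r.
  rewrite big1 ?addr0 // => i ij; by rewrite !ffunE (negPf ij) mul0r.
by rewrite linear_sum /=; apply: eq_bigr => i _; rewrite gL gy fL.
Qed.

Section StdResolution.
Variable M : rmodule A.

Definition std_obj i : rmodule A := cover (iter i syzygy M).

Definition std_d i : 'Hom(std_obj i.+1, std_obj i) :=
  (syzygy_incl (iter i syzygy M) \o cover_map (iter i.+1 syzygy M))%VF.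

Fact std_d_rlinear i : rlinear (std_d i).
Proof.
exact: rlinear_comp (@syzygy_incl_rlinear _) (@cover_map_rlinear _).
Qed.

Lemma limg_std_d i : limg (std_d i) = lker (cover_map (iter i syzygy M)).
Proof. by rewrite /std_d limg_comp cover_map_surj limg_syzygy_incl. Qed.

Fact std_exact i : limg (std_d i.+1) = lker (std_d i).
Proof.
rewrite limg_std_d; apply/vspaceP => x.
rewrite !memv_ker [std_d i x]comp_lfunE -[X in _ = X]memv_ker.
by rewrite lker_syzygy_incl memv0.
Qed.

Definition std_resolution : proj_resolution M :=
  ProjResolution (fun i => @rfree_projective _) std_d_rlinear
    (@cover_map_rlinear M) (cover_map_surj M) (limg_std_d 0) std_exact.

End StdResolution.

Section Ext.

Section Cohomology.
Variables (M : rmodule A) (R : proj_resolution M) (N : rmodule A).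

Definition cocycles i : {vspace 'Hom(R i, N)} :=
  (rhom (R i) N :&: lker (linfun (precomp (W := N) (res_d R i))))%VS.

Definition coboundaries i : {vspace 'Hom(R i, N)} :=
  match i with
  | 0 => 0%VS
  | j.+1 => (linfun (precomp (W := N) (res_d R j)) @: rhom (R j) N)%VS
  end.

Lemma cocyclesP i f :
  f \in cocycles i <-> rlinear f /\ (f \o res_d R i)%VF = 0.
Proof.
rewrite memv_cap memv_ker lfunE /= /precomp; split.
  by case/andP => /rhomP fL /eqP.
by case=> /rhomP -> ->; rewrite eqxx.
Qed.

Lemma coboundariesP i f :
  f \in coboundaries i.+1 <->
  exists2 g, rlinear g & f = (g \o res_d R i)%VF.
Proof.
split=> [/memv_imgP[g /rhomP gL ->] | [g /rhomP gL ->]].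
  by exists g; rewrite // lfunE.
by apply/memv_imgP; exists g; rewrite // lfunE.
Qed.

Lemma res_dd i : (res_d R i \o res_d R i.+1)%VF = 0.
Proof.
apply/lfunP => x; rewrite comp_lfunE zero_lfunE; apply/eqP.
by rewrite -memv_ker -res_exact memv_img ?memvf.
Qed.

Lemma sub_coboundaries i : (coboundaries i <= cocycles i)%VS.
Proof.
case: i => [|i]; first exact: sub0v.
apply/subvP => f /coboundariesP[g gL ->]; apply/cocyclesP; split.
  exact: rlinear_comp (@res_d_rlinear _ R i).
by rewrite -comp_lfunA res_dd comp_lfun0r.
Qed.

End Cohomology.

(** Ext^i_A(M, N): the i-th cohomology of Hom_A(R, N), where R is the standard
    free resolution of M. *)
Definition Ext i M N : vectType k :=
  vquot (cocycles (std_resolution M) N i) (coboundaries (std_resolution M) N i).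

Definition Ext_class i M N (f : 'Hom(std_resolution M i, N)) : Ext i M N :=
  vquot_pi _ _ f.

Definition Ext_map i M N N' (h : 'Hom(N, N')) (e : Ext i M N) : Ext i M N' :=
  Ext_class (h \o vsval e)%VF.

Lemma cocycles_postcomp i M N N' (h : 'Hom(N, N')) f : rlinear h ->
  f \in cocycles (std_resolution M) N i ->
  (h \o f)%VF \in cocycles (std_resolution M) N' i.
Proof.
move=> hL /cocyclesP[fL f0]; apply/cocyclesP; split; first exact: rlinear_comp.
by rewrite -comp_lfunA f0 comp_lfun0r.
Qed.

Lemma coboundaries_postcomp i M N N' (h : 'Hom(N, N')) f : rlinear h ->
  f \in coboundaries (std_resolution M) N i ->
  (h \o f)%VF \in coboundaries (std_resolution M) N' i.
Proof.
move=> hL; case: i f => [|i] f.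
  by rewrite !memv0 => /eqP->; rewrite comp_lfun0r.
move=> /coboundariesP[g gL ->]; apply/coboundariesP.
by exists (h \o g)%VF; [exact: rlinear_comp | rewrite comp_lfunA].
Qed.

Lemma Ext_map_class i M N N' (h : 'Hom(N, N')) f : rlinear h ->
  f \in cocycles (std_resolution M) N i ->
  Ext_map h (Ext_class f) = Ext_class (h \o f)%VF.
Proof.
move=> hL fZ; have sBZ X := sub_coboundaries (std_resolution M) X i.
apply/esym/eqP; rewrite -subr_eq0 /Ext_map /Ext_class.
rewrite -linearB -comp_lfunNr -comp_lfunDr.
have fB := coboundaries_postcomp hL (vquot_piB _ fZ).
by rewrite vquot_eq0 // (subvP (sBZ N')).
Qed.

Definition Ext_lact i M (a : A) : Ext i M rreg -> Ext i M rreg :=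
  Ext_map (N := rreg) (N' := rreg) (amull a).

Fact amull_rlinear a : rlinear (M := rreg) (N := rreg) (amull a).
Proof. by move=> x b; rewrite !lfunE /= mulrA. Qed.

Fact Ext_lact_linearl i M (e : Ext i M rreg) : linear ((@Ext_lact i M)^~ e).
Proof.
move=> c a b; rewrite /Ext_lact /Ext_map /Ext_class -linearP.
congr (vquot_pi _ _ _); apply/lfunP => x.
rewrite add_lfunE scale_lfunE !comp_lfunE !lfunE /=.
by rewrite mulrDl scalerAl.
Qed.

Fact Ext_lact_linearr i M a : linear (@Ext_lact i M a).
Proof.
move=> c e e'; rewrite /Ext_lact /Ext_map /Ext_class -linearP.
congr (vquot_pi _ _ _); apply/lfunP => x.
by rewrite add_lfunE scale_lfunE !comp_lfunE add_lfunE scale_lfunE linearP.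
Qed.

Fact Ext_lact1 i M (e : Ext i M rreg) : Ext_lact 1 e = e.
Proof.
rewrite /Ext_lact /Ext_map -[RHS]vquot_piK; congr (vquot_pi _ _ _).
by apply/lfunP => x; rewrite comp_lfunE lfunE /= mul1r.
Qed.

Fact Ext_lactM i M a b (e : Ext i M rreg) :
  Ext_lact (a * b) e = Ext_lact a (Ext_lact b e).
Proof.
rewrite /Ext_lact {3}/Ext_map Ext_map_class; first last.
- exact/cocycles_postcomp/vquot_val/amull_rlinear.
- exact: amull_rlinear.
rewrite /Ext_map comp_lfunA; congr (Ext_class (_ \o _)%VF).
by apply/lfunP => x; rewrite comp_lfunE !lfunE /= mulrA.
Qed.

(** Ext^i_A(M, A) as a left A-module, A acting by functoriality through the
    endomorphisms x |-> a * x of the right module A. *)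
Definition Ext_lmodule i M : lmodule A :=
  LModule (@Ext_lact_linearl i M) (@Ext_lact_linearr i M)
    (@Ext_lact1 i M) (@Ext_lactM i M).

End Ext.

Definition tau n M : rmodule A := dual (Ext_lmodule n M).

(** Full subcategories are given by their objects. *)
Definition subcategory (C : rmodule A -> Prop) : Prop :=
  [/\ forall X Y, riso X Y -> C X -> C Y,
      C rzero,
      forall X Y, C X -> C Y -> C (dsum X Y)
    & forall X Y, C (dsum X Y) -> C X].

Inductive add_closure (S : rmodule A -> Prop) : rmodule A -> Prop :=
  | add_gen X : S X -> add_closure S X
  | add_iso X Y : riso X Y -> add_closure S X -> add_closure S Y
  | add_zero : add_closure S rzero
  | add_dsum X Y : add_closure S X -> add_closure S Y -> add_closure S (dsum X Y)
  | add_summand X Y : add_closure S (dsum X Y) -> add_closure S X.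

Definition add_obj M : rmodule A -> Prop := add_closure (fun X => X = M).

Definition contravariantly_finite (C : rmodule A -> Prop) : Prop :=
  forall X, exists Y (f : 'Hom(Y, X)), [/\ C Y, rlinear f &
    forall Z (g : 'Hom(Z, X)), C Z -> rlinear g ->
      exists2 h : 'Hom(Z, Y), rlinear h & g = (f \o h)%VF].

Definition covariantly_finite (C : rmodule A -> Prop) : Prop :=
  forall X, exists Y (f : 'Hom(X, Y)), [/\ C Y, rlinear f &
    forall Z (g : 'Hom(X, Z)), C Z -> rlinear g ->
      exists2 h : 'Hom(Y, Z), rlinear h & g = (h \o f)%VF].

Definition functorially_finite (C : rmodule A -> Prop) : Prop :=
  contravariantly_finite C /\ covariantly_finite C.

Definition Ext_vanishes i X Y : Prop := forall e : Ext i X Y, e = 0.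

Definition cluster_tilting n (C : rmodule A -> Prop) : Prop :=
  [/\ subcategory C,
      functorially_finite C,
      forall X, C X <->
        forall Y, C Y -> forall i, (0 < i < n)%N -> Ext_vanishes i X Y
    & forall X, C X <->
        forall Y, C Y -> forall i, (0 < i < n)%N -> Ext_vanishes i Y X].

End Modules.

Definition tau_orbit (k : fieldType) (A : falgType k) (n : nat) :
    rmodule A -> Prop :=
  add_closure (fun X => exists i : nat, X = iter i (tau n) (dual (lreg A))).

(* Main.v *)
(** Write [nu = D Hom_A(-, A)] and let [C] be any n-cluster tilting subcategory.
    Since gl.dim A <= n, [D Ext^n(X, Z) = Hom(Z, tau_n X)]. If moreover
    [Ext^j(X, A) = 0] for 0 < j < n, as holds for [X] in [C], then [nu] turns a
    projective resolution of [X] into an injective coresolution of [tau_n X];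
    since [Hom(Z, nu P) = D Hom(P, Z)], it follows that [Ext^(n-j)(X, Z) = 0]
    implies [Ext^j(Z, tau_n X) = 0] for 0 < j <= n. Hence [tau_n C] lies in [C],
    and [Hom(X, Z) = 0] implies [Hom(tau_n X, tau_n Z) = 0] for [X] in [C]; so
    [C] contains the orbit of [DA].

    Conversely, let [L] be in [C]. Pulling an injective coresolution of [L] back
    along [nu] gives a projective resolution of some [Y] in [C] such that [L] is
    a summand of [tau_n Y + injective], and [Hom(L, tau_n Z) = 0] implies
    [Hom(Y, Z) = 0]. Iterating from [L_0 = A] yields [L_0, L_1, ...] in [C] with
    [Hom(L_j, L_i) = 0] for i < j. When [C = add M], the nonzero [L_i]
    contribute linearly independent endomorphisms of [M], so that some [L_i]
    vanishes and [A] lies in the orbit of [DA]. As [Hom(tau_n^i DA, tau_n^l Z) =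
    0] for i < l and [Z] in [C], this gives [Hom(A, tau_n^l Z) = 0], i.e.
    [tau_n^l Z = 0], for large l. Going down from l to 0 by means of the modules
    [Y], every object of [C] lies in the orbit. *)

From HB Require Import structures.
Require Import Defs.
From mathcomp Require Import all_boot all_order all_algebra all_field.

Set Implicit Arguments.
Unset Strict Implicit.
Unset Printing Implicit Defensive.

Import GRing.Theory.
Import Defs.

(** * Linear algebra and short exact sequences *)

Section LinearAlgebra.
Local Open Scope ring_scope.
Variable k : fieldType.
Implicit Types U V W : vectType k.

Definition hom_of U V (F : U -> V) (F_lin : linear F) : 'Hom(U, V) :=
  locked (linfun (HB.pack_for {linear U -> V} F
    (GRing.isSemilinear.Build k U V _ F (GRing.semilinear_linear F_lin)))).

Lemma hom_ofE U V (F : U -> V) (F_lin : linear F) : hom_of F_lin =1 F.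
Proof. by move=> x; rewrite /hom_of -lock lfunE. Qed.

Lemma hom_inj U V (f : 'Hom(U, V)) x y :
  (forall x, f x = 0 -> x = 0) -> f x = f y -> x = y.
Proof.
move=> f_inj xy; apply/eqP; rewrite -subr_eq0; apply/eqP/f_inj.
by rewrite linearB /= xy subrr.
Qed.

Lemma limg_fullP U V (f : 'Hom(U, V)) :
  limg f = fullv <-> forall y, exists x, y = f x.
Proof.
split=> [fS y | fS]; first by exists (f^-1%VF y);
  rewrite limg_lfunVK ?fS ?memvf.
apply/eqP; rewrite eqEsubv subvf; apply/subvP => y _.
by have [x ->] := fS y; rewrite memv_img ?memvf.
Qed.

(** Exactness of duality over [k]: the witness is [phi] after a linear pseudo-inverse of [h]
    restricted to [S]. It serves to factor functionals through precomposition maps. *)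
Lemma functional_factor U V (h : 'Hom(U, V)) (S : {vspace U})
    (phi : 'Hom(U, k^o)) :
  (forall u, u \in S -> h u = 0 -> phi u = 0) ->
  exists psi : 'Hom(V, k^o), forall u, u \in S -> psi (h u) = phi u.
Proof.
move=> phi0; pose h' := (h \o projv S)%VF.
exists (phi \o projv S \o h'^-1)%VF => u uS; rewrite !comp_lfunE.
apply/eqP; rewrite -subr_eq0 -linearB; apply/eqP/phi0.
  by rewrite rpredB ?memv_proj.
have hE : h u = h' u by rewrite comp_lfunE projv_id.
rewrite linearB /= -[h (projv S _)]comp_lfunE -/h' limg_lfunVK ?subrr //.
by rewrite hE memv_img ?memvf.
Qed.

(** Removing from [u] its projection to [S] leaves a nonzero vector, and a nonzero coordinate of it
    gives [phi]. *)
Lemma functional_sep U (S : {vspace U}) u : u \notin S ->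
  exists2 phi : 'Hom(U, k^o), forall v, v \in S -> phi v = 0 & phi u != 0.
Proof.
move=> uS; pose w := u - projv S u.
have w0 : w != 0.
  by apply: contra uS; rewrite subr_eq0 => /eqP ->; rewrite memv_proj.
have [i wi] : exists i, coord (vbasis {:U}) i w != 0.
  apply/existsP; apply: contraR w0; rewrite negb_exists => /forallP w0.
  rewrite (coord_vbasis (memvf w)) big1 // => i _.
  by have := w0 i; rewrite negbK => /eqP->; rewrite scale0r.
have cL : linear (fun v => coord (vbasis {:U}) i (v - projv S v) : k^o).
  by move=> a x y; rewrite linearP opprD addrACA -scalerBr linearP.
exists (hom_of cL) => [v vS|]; rewrite hom_ofE //.
by rewrite projv_id // subrr linear0.
Qed.

End LinearAlgebra.

Section Modules.
Local Open Scope ring_scope.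
Variables (k : fieldType) (A : falgType k).
Implicit Types K L M N P U V W X Y Z I J : rmodule A.

Lemma ractBl M (x y : M) a : ract (x - y) a = ract x a - ract y a.
Proof. exact: (linearB (ract_by a)). Qed.

Lemma ractDl M (x y : M) a : ract (x + y) a = ract x a + ract y a.
Proof. exact: (linearD (ract_by a)). Qed.

Lemma ract0l M a : ract (0 : M) a = 0.
Proof. exact: (linear0 (ract_by a)). Qed.

Lemma ract_suml M (I : finType) (F : I -> M) a :
  ract (\sum_i F i) a = \sum_i ract (F i) a.
Proof. exact: (linear_sum (ract_by a)). Qed.

Lemma rlinear0 M N : rlinear (0 : 'Hom(M, N)).
Proof. by move=> x a; rewrite !zero_lfunE ract0l. Qed.

Lemma rlinear1 M : rlinear (\1 : 'Hom(M, M))%VF.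
Proof. by move=> x a; rewrite !id_lfunE. Qed.

Lemma rlinearD M N (f g : 'Hom(M, N)) : rlinear f -> rlinear g ->
  rlinear (f + g).
Proof. by move=> fL gL x a; rewrite !add_lfunE fL gL ractDl. Qed.

Lemma rlinearB M N (f g : 'Hom(M, N)) : rlinear f -> rlinear g ->
  rlinear (f - g).
Proof.
by move=> fL gL x a; rewrite !add_lfunE !opp_lfunE fL gL ractBl.
Qed.

Lemma lift_along_inj K M Z (i : 'Hom(K, M)) (f : 'Hom(Z, M)) :
  rlinear i -> (forall x, i x = 0 -> x = 0) -> rlinear f ->
  (forall z, exists x, f z = i x) ->
  exists2 g : 'Hom(Z, K), rlinear g & forall z, f z = i (g z).
Proof.
move=> iL i_inj fL fi; have ig z : i ((i^-1 \o f)%VF z) = f z.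
  by rewrite comp_lfunE limg_lfunVK //; have [x ->] := fi z;
    rewrite memv_img ?memvf.
exists (i^-1 \o f)%VF => // z a; apply/eqP; rewrite -subr_eq0; apply/eqP/i_inj.
by rewrite linearB /= iL !ig fL subrr.
Qed.

Lemma factor_through_surj M W Z (p : 'Hom(M, W)) (f : 'Hom(M, Z)) :
  rlinear p -> (forall y, exists x, y = p x) -> rlinear f ->
  (forall x, p x = 0 -> f x = 0) ->
  exists2 g : 'Hom(W, Z), rlinear g & forall x, f x = g (p x).
Proof.
move=> pL p_surj fL f0.
have gp x : (f \o p^-1)%VF (p x) = f x.
  rewrite comp_lfunE; apply/eqP; rewrite -subr_eq0 -linearB; apply/eqP/f0.
  by rewrite linearB /= limg_lfunVK ?subrr // memv_img ?memvf.
exists (f \o p^-1)%VF => // y a; have [x ->] := p_surj y.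
by rewrite -pL !gp fL.
Qed.

Record ses K P W (i : 'Hom(K, P)) (p : 'Hom(P, W)) : Prop := Ses {
  ses_rlinear_i : rlinear i;
  ses_rlinear_p : rlinear p;
  ses_inj : forall x, i x = 0 -> x = 0;
  ses_surj : forall y, exists x, y = p x;
  ses_comp : forall x, p (i x) = 0;
  ses_exact : forall y, p y = 0 -> exists x, y = i x }.

Lemma ses_lift K P W (i : 'Hom(K, P)) (p : 'Hom(P, W)) Z (f : 'Hom(Z, P)) :
  ses i p -> rlinear f -> (forall z, p (f z) = 0) ->
  exists2 g : 'Hom(Z, K), rlinear g & forall z, f z = i (g z).
Proof.
case=> iL _ i_inj _ _ ex fL pf0; apply: lift_along_inj => // z; exact: ex.
Qed.

Lemma ses_desc K P W (i : 'Hom(K, P)) (p : 'Hom(P, W)) Z (f : 'Hom(P, Z)) :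
  ses i p -> rlinear f -> (forall x, f (i x) = 0) ->
  exists2 g : 'Hom(W, Z), rlinear g & forall x, f x = g (p x).
Proof.
case=> _ pL _ p_surj _ ex fL fi0; apply: factor_through_surj => // x /ex[y ->].
exact: fi0.
Qed.

Lemma ses_eq K P W (i : 'Hom(K, P)) (p : 'Hom(P, W)) x y :
  ses i p -> i x = i y -> x = y.
Proof. by move/ses_inj/hom_inj; apply. Qed.

Lemma ses_kernel M W (p : 'Hom(M, W)) : rlinear p ->
  (forall y, exists x, y = p x) ->
  exists K, exists i : 'Hom(K, M), ses i p.
Proof.
move=> pL p_surj.
have st x a : x \in lker p -> ract x a \in lker p.
  by rewrite !memv_ker pL => /eqP ->; rewrite ract0l.
exists (rsub st), (linfun (fun u : rsub st => vsval u)); split=> //.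
- by move=> x a; rewrite !lfunE.
- by move=> x; rewrite lfunE /= => x0; apply: val_inj.
- by move=> x; rewrite lfunE /=; apply/eqP; rewrite -memv_ker subvsP.
by move=> y /eqP; rewrite -memv_ker => yK; exists (Subvs yK); rewrite lfunE.
Qed.

Section Quotient.
Variables (M : rmodule A) (B : {vspace M}).
Hypothesis stabB : forall x a, x \in B -> ract x a \in B.

Let q := vquot fullv B.
Let pi (x : M) : q := vquot_pi fullv B x.

Let pi_eq x y : x - y \in B -> pi x = pi y.
Proof.
move=> xy; apply/eqP; rewrite -subr_eq0 -linearB vquot_eq0 ?subvf ?memvf //.
Qed.

Let pi_valB x : x - vsval (pi x) \in B.
Proof. by rewrite vquot_piB ?subvf ?memvf. Qed.

Definition rquot_act (u : q) (a : A) : q := pi (ract (vsval u) a).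

Let pi_act x a : rquot_act (pi x) a = pi (ract x a).
Proof.
by apply/esym/pi_eq; rewrite -ractBl stabB ?pi_valB.
Qed.

Fact rquot_linearl a : linear (rquot_act^~ a).
Proof.
move=> c u v; rewrite /rquot_act.
have -> : vsval (c *: u + v) = c *: vsval u + vsval v by [].
by rewrite ract_linearl /pi linearP.
Qed.

Fact rquot_linearr u : linear (rquot_act u).
Proof. by move=> c a b; rewrite /rquot_act /pi ract_linearr linearP. Qed.

Fact rquot_act1 u : rquot_act u 1 = u.
Proof. by rewrite /rquot_act ract1 /pi vquot_piK. Qed.

Fact rquot_actM u a b : rquot_act u (a * b) = rquot_act (rquot_act u a) b.
Proof.
by rewrite -[RHS]/(rquot_act (pi (ract (vsval u) a)) b) pi_act /rquot_act ractM.
Qed.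

Definition rquot : rmodule A :=
  RModule rquot_linearl rquot_linearr rquot_act1 rquot_actM.

Definition rquot_map : 'Hom(M, rquot) := linfun (vquot_pi fullv B).

Lemma rquot_map_rlinear : rlinear rquot_map.
Proof. by move=> x a; rewrite !lfunE /=; exact/esym/pi_act. Qed.

Lemma rquot_map_surj y : exists x, y = rquot_map x.
Proof. by exists (vsval y); rewrite lfunE /= vquot_piK. Qed.

Lemma rquot_map_eq0 x : (rquot_map x == 0) = (x \in B).
Proof. by rewrite lfunE /= vquot_eq0 ?subvf ?memvf. Qed.

End Quotient.

Lemma ses_cokernel K M (i : 'Hom(K, M)) : rlinear i ->
  (forall x, i x = 0 -> x = 0) ->
  exists W, exists p : 'Hom(M, W), ses i p.
Proof.
move=> iL i_inj.
have st x a : x \in limg i -> ract x a \in limg i.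
  by case/memv_imgP => y _ ->; rewrite -iL memv_img ?memvf.
exists (rquot st), (rquot_map st); split=> //.
- exact: rquot_map_rlinear.
- exact: rquot_map_surj.
- by move=> x; apply/eqP; rewrite rquot_map_eq0 memv_img ?memvf.
by move=> y /eqP; rewrite rquot_map_eq0 => /memv_imgP[x _ ->]; exists x.
Qed.

Lemma image_factor M N (f : 'Hom(M, N)) : rlinear f ->
  exists U, exists q : 'Hom(M, U), exists i : 'Hom(U, N),
    [/\ rlinear q, rlinear i, forall y, exists x, y = q x,
        forall x, i x = 0 -> x = 0 & forall x, f x = i (q x)].
Proof.
move=> fL.
have st x a : x \in limg f -> ract x a \in limg f.
  by case/memv_imgP => y _ ->; rewrite -fL memv_img ?memvf.
pose i : 'Hom(rsub st, N) := linfun (fun u : rsub st => vsval u).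
have iL : rlinear i by move=> x a; rewrite !lfunE.
have i_inj x : i x = 0 -> x = 0 by rewrite lfunE /= => x0; apply: val_inj.
have [|q qL fE] := lift_along_inj iL i_inj fL.
  by move=> z; exists (Subvs (memv_img f (memvf z))); rewrite lfunE.
exists (rsub st), q, i; split=> // y.
have /memv_imgP[x _ yE] := subvsP y; exists x; apply/eqP; rewrite -subr_eq0.
by apply/eqP/i_inj; rewrite linearB /= -fE lfunE /= yE subrr.
Qed.

Lemma copair_exists M N Z (f : 'Hom(M, Z)) (g : 'Hom(N, Z)) :
  rlinear f -> rlinear g ->
  exists2 h : 'Hom(dsum M N, Z), rlinear h & forall x, h x = f x.1 + g x.2.
Proof.
move=> fL gL.
have hL : linear (fun x : dsum M N => f x.1 + g x.2).
  by move=> a x y; rewrite !linearP scalerDr addrACA.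
exists (hom_of hL) => [x a|x]; rewrite !hom_ofE //=.
by rewrite fL gL ractDl.
Qed.

Lemma pair_exists M N Z (f : 'Hom(Z, M)) (g : 'Hom(Z, N)) :
  rlinear f -> rlinear g ->
  exists2 h : 'Hom(Z, dsum M N), rlinear h & forall z, h z = (f z, g z).
Proof.
move=> fL gL.
have hL : linear (fun z => (f z, g z) : dsum M N).
  by move=> a x y; rewrite !linearP.
exists (hom_of hL) => [x a|x]; rewrite !hom_ofE //=.
by rewrite fL gL.
Qed.

Lemma ses_cover W : ses (syzygy_incl W) (cover_map W).
Proof.
split; [exact: syzygy_incl_rlinear|exact: cover_map_rlinear| | | |].
- by move=> x /eqP; rewrite -memv_ker lker_syzygy_incl memv0 => /eqP.
- exact/limg_fullP/cover_map_surj.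
- move=> x; apply/eqP; rewrite -memv_ker -limg_syzygy_incl memv_img ?memvf //.
move=> y /eqP; rewrite -memv_ker -limg_syzygy_incl => /memv_imgP[x _ ->].
by exists x.
Qed.

Lemma projective_lift P M N (g : 'Hom(M, N)) (f : 'Hom(P, N)) :
  projective P -> rlinear g -> rlinear f -> (forall y, exists x, y = g x) ->
  exists2 h : 'Hom(P, M), rlinear h & forall x, g (h x) = f x.
Proof.
move=> prP gL fL /limg_fullP gS; have [h hL <-] := prP _ _ _ _ gL fL gS.
by exists h => // x; rewrite comp_lfunE.
Qed.

Lemma cover_projective W : projective (cover W).
Proof. exact: rfree_projective. Qed.

End Modules.

(** * Vanishing of Ext *)

Section Ext1.
Local Open Scope ring_scope.
Variables (k : fieldType) (A : falgType k).
Implicit Types K L M N P U V W X Y Z I J : rmodule A.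

(* [Ext^1(W, L) = 0] *)
Definition E1 W L : Prop :=
  forall c : 'Hom(syzygy W, L), rlinear c ->
  exists2 e : 'Hom(cover W, L), rlinear e &
    forall x, c x = e (syzygy_incl W x).

(** Phrased through [Ext^1], the form used in dimension shifting; [injective_extend] recovers
    extension along arbitrary monomorphisms. *)
Definition injective_mod I : Prop := forall Z, E1 Z I.

(** The map lifts on the free cover of [W]; on the syzygy the lift takes values in [L], and once
    that part is extended to the cover and subtracted, the lift descends to [W]. *)
Lemma E1_lift W L I J (i : 'Hom(L, I)) (p : 'Hom(I, J)) (g : 'Hom(W, J)) :
  E1 W L -> ses i p -> rlinear g ->
  exists2 h : 'Hom(W, I), rlinear h & forall x, p (h x) = g x.
Proof.
move=> WL ip gL; have cW := ses_cover W.
have [u uL uE] := projective_lift (@cover_projective _ _ W) (ses_rlinear_p ip)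
  (rlinear_comp gL (ses_rlinear_p cW)) (ses_surj ip).
have [||c cL cE] := @ses_lift _ _ _ _ _ _ _ _ (u \o syzygy_incl W)%VF ip.
- exact: rlinear_comp (ses_rlinear_i cW).
- by move=> z; rewrite comp_lfunE uE comp_lfunE (ses_comp cW) linear0.
have [e eL eE] := WL c cL.
have [||h hL hE] := ses_desc (f := u - (i \o e)%VF) cW.
- by apply: rlinearB => //; apply: rlinear_comp => //; exact: ses_rlinear_i ip.
- move=> x; rewrite add_lfunE opp_lfunE comp_lfunE -eE -cE.
  by rewrite comp_lfunE subrr.
exists h => // x; have [y ->] := ses_surj cW x.
rewrite -hE add_lfunE opp_lfunE comp_lfunE linearB /= (ses_comp ip) subr0 uE.
by rewrite comp_lfunE.
Qed.

Lemma E1_ext K P W L (i : 'Hom(K, P)) (p : 'Hom(P, W)) (c : 'Hom(K, L)) :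
  E1 W L -> ses i p -> rlinear c ->
  exists2 e : 'Hom(P, L), rlinear e & forall x, c x = e (i x).
Proof.
move=> WL ip cL; have cW := ses_cover W.
have [u uL uE] := projective_lift (@cover_projective _ _ W) (ses_rlinear_p ip)
  (ses_rlinear_p cW) (ses_surj ip).
have [||v vL vE] := @ses_lift _ _ _ _ _ _ _ _ (u \o syzygy_incl W)%VF ip.
- exact: rlinear_comp (ses_rlinear_i cW).
- by move=> z; rewrite comp_lfunE uE (ses_comp cW).
have [w wL wE] := WL _ (rlinear_comp cL vL).
have [s sL sE] := copair_exists (ses_rlinear_i ip) uL.
have [f fL fE] := copair_exists cL wL.
(* [P] is a quotient of [K + cover W], to which [c + w] descends *)
have [y||e eL eE] := factor_through_surj sL _ fL.
- have [x xE] := ses_surj cW (p y).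
  have [|z zE] := ses_exact ip (y := y - u x).
    by rewrite linearB /= uE xE subrr.
  by exists (z, x); rewrite sE /= -zE subrK.
- move=> [y x]; rewrite sE fE /= => yx0.
  have [|z zE] := ses_exact cW (y := x).
    by rewrite -uE -[u x](addKr (i y)) yx0 addr0 linearN /= (ses_comp ip) oppr0.
  rewrite zE -wE comp_lfunE -linearD /=.
  have -> : y + v z = 0; last by rewrite linear0.
  by apply: (ses_inj ip); rewrite linearD /= -vE comp_lfunE -zE.
exists e => // x.
have := eE (x, 0); rewrite fE sE /= !linear0 !addr0; exact.
Qed.

Lemma E1_of_inj W L I J (i : 'Hom(L, I)) (p : 'Hom(I, J)) :
  ses i p -> injective_mod I ->
  (forall g : 'Hom(W, J), rlinear g ->
     exists2 h : 'Hom(W, I), rlinear h & forall x, p (h x) = g x) ->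
  E1 W L.
Proof.
move=> ip injI lift c cL; have cW := ses_cover W.
have [u uL uE] := injI W _ (rlinear_comp (ses_rlinear_i ip) cL).
have [||g gL gE] := ses_desc (f := (p \o u)%VF) cW.
- exact: rlinear_comp (ses_rlinear_p ip) uL.
- by move=> x; rewrite comp_lfunE -uE comp_lfunE (ses_comp ip).
have [h hL hE] := lift g gL.
have [||e eL eE] := ses_lift (f := u - (h \o cover_map W)%VF) ip.
- by apply: rlinearB => //; apply: rlinear_comp => //; exact: ses_rlinear_p cW.
- move=> z; rewrite add_lfunE opp_lfunE comp_lfunE linearB /= hE -gE.
  by rewrite comp_lfunE subrr.
exists e => // x; apply/eqP; rewrite -subr_eq0; apply/eqP/(ses_inj ip).
rewrite linearB /= -eE add_lfunE opp_lfunE -uE !comp_lfunE (ses_comp cW).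
by rewrite linear0 subr0 subrr.
Qed.

(** Lifts [a : cover W -> P] and [b : P -> cover W] of the identity of [W] exist, and [b \o a]
    differs from the identity by a map [s] into the syzygy. The extension found on [P] is
    transported by [a] and corrected by [c \o s]. *)
Lemma E1_of_proj K P W L (i : 'Hom(K, P)) (p : 'Hom(P, W)) :
  ses i p -> projective P ->
  (forall c : 'Hom(K, L), rlinear c ->
     exists2 e : 'Hom(P, L), rlinear e & forall x, c x = e (i x)) ->
  E1 W L.
Proof.
move=> ip prP ext c cL; have cW := ses_cover W.
have [b bL bE] := projective_lift prP (ses_rlinear_p cW) (ses_rlinear_p ip)
  (ses_surj cW).
have [a aL aE] := projective_lift (@cover_projective _ _ W) (ses_rlinear_p ip)
  (ses_rlinear_p cW) (ses_surj ip).
have [||b1 b1L b1E] := ses_lift (f := (b \o i)%VF) cW.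
- exact: rlinear_comp (ses_rlinear_i ip).
- by move=> z; rewrite comp_lfunE bE (ses_comp ip).
have [||a1 a1L a1E] := ses_lift (f := (a \o syzygy_incl W)%VF) ip.
- exact: rlinear_comp (ses_rlinear_i cW).
- by move=> z; rewrite comp_lfunE aE (ses_comp cW).
have [||s sL sE] := ses_lift (f := (b \o a)%VF - \1%VF) cW.
- by apply: rlinearB; [exact: rlinear_comp | exact: rlinear1].
- move=> z; rewrite add_lfunE opp_lfunE comp_lfunE id_lfunE linearB /=.
  by rewrite bE aE subrr.
have [v vL vE] := ext _ (rlinear_comp cL b1L).
exists ((v \o a)%VF - (c \o s)%VF).
  by apply: rlinearB; exact: rlinear_comp.
move=> x; rewrite add_lfunE opp_lfunE !comp_lfunE.
have -> : a (syzygy_incl W x) = i (a1 x) by rewrite -a1E comp_lfunE.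
rewrite -vE comp_lfunE -linearB /=; congr (c _).
apply/eqP; rewrite -subr_eq0; apply/eqP/(ses_inj cW).
rewrite !linearB /= -sE -b1E add_lfunE opp_lfunE id_lfunE !comp_lfunE.
by rewrite -a1E comp_lfunE opprK addKr subrr.
Qed.

Lemma projective_E1 P L : projective P -> E1 P L.
Proof.
move=> prP; pose z : 'Hom(rzero A, P) := 0.
have zE (x : rzero A) : x = 0 by apply/ffunP => - [].
apply: (@E1_of_proj _ _ _ _ z \1%VF) => //.
  split; rewrite /z.
  - exact: rlinear0.
  - exact: rlinear1.
  - by move=> x _; exact: zE.
  - by move=> y; exists y; rewrite id_lfunE.
  - by move=> x; rewrite zero_lfunE linear0.
  - by move=> y; rewrite id_lfunE => ->; exists 0; rewrite zero_lfunE.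
move=> c _; exists 0; first exact: rlinear0.
by move=> x; rewrite (zE x) !linear0.
Qed.

Lemma E1_projective P : (forall L, E1 P L) -> projective P.
Proof.
move=> E1P M N g f gL fL /limg_fullP gS.
have [K [i ig]] := ses_kernel gL gS.
have [h hL hE] := E1_lift (E1P K) ig fL.
by exists h => //; apply/lfunP => x; rewrite comp_lfunE hE.
Qed.

Lemma injective_extend I U V (i : 'Hom(U, V)) (c : 'Hom(U, I)) :
  injective_mod I -> rlinear i -> (forall x, i x = 0 -> x = 0) -> rlinear c ->
  exists2 e : 'Hom(V, I), rlinear e & forall x, c x = e (i x).
Proof.
move=> injI iL i_inj cL; have [W [p ip]] := ses_cokernel iL i_inj.
exact: E1_ext (injI W) ip cL.
Qed.

(** Both sides express the vanishing of [Ext^2(W, L)]. *)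
Lemma E1_shift K P W L I J (i : 'Hom(K, P)) (p : 'Hom(P, W))
    (j : 'Hom(L, I)) (q : 'Hom(I, J)) :
  ses i p -> projective P -> ses j q -> injective_mod I ->
  (E1 K L <-> E1 W J).
Proof.
move=> ip prP jq injI; split=> H.
  apply: (E1_of_proj ip) => // c cL.
  have [h hL hE] := E1_lift H jq cL.
  have [e eL eE] := injective_extend injI (ses_rlinear_i ip) (ses_inj ip) hL.
  exists (q \o e)%VF; first exact: rlinear_comp (ses_rlinear_p jq) eL.
  by move=> x; rewrite comp_lfunE -eE hE.
apply: (E1_of_inj jq) => // g gL.
have [e eL eE] := E1_ext H ip gL.
have [h hL hE] := projective_lift prP (ses_rlinear_p jq) eL (ses_surj jq).
exists (h \o i)%VF; first exact: rlinear_comp hL (ses_rlinear_i ip).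
by move=> x; rewrite comp_lfunE hE eE.
Qed.

End Ext1.

(** * Higher Ext as Ext^1 of syzygies *)

Section Resolutions.
Local Open Scope ring_scope.
Variables (k : fieldType) (A : falgType k).
Implicit Types K L M N P U V W X Y Z I J : rmodule A.

(** A cocycle in degree [i + 1] descends to a map from [syzygy W], and it is a coboundary when that
    map extends to [cover W]. *)
Lemma Ext_vanishesE i X Y :
  Ext_vanishes i.+1 X Y <-> E1 (iter i (@syzygy k A) X) Y.
Proof.
set W := iter i _ X; have cW := ses_cover W; have cW' := ses_cover (syzygy W).
split=> [H c cL | H e].
  pose z : 'Hom(std_resolution X i.+1, Y) := (c \o cover_map (syzygy W))%VF.
  have zZ : z \in cocycles (std_resolution X) Y i.+1.
    apply/cocyclesP; split; first exact: rlinear_comp (ses_rlinear_p cW').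
    apply/lfunP => x; rewrite zero_lfunE !comp_lfunE.
    by rewrite (ses_comp cW') linear0.
  have /eqP := H (Ext_class z); rewrite vquot_eq0 ?sub_coboundaries //.
  case/coboundariesP => g gL /lfunP zE; exists g => // x.
  by have [y ->] := ses_surj cW' x; have := zE y; rewrite !comp_lfunE.
have [z zZ <-] := vquot_surj e; apply/eqP;
  rewrite vquot_eq0 ?sub_coboundaries //.
have /cocyclesP[zL /lfunP z0] := zZ.
have [|c cL cE] := factor_through_surj (ses_rlinear_p cW') (ses_surj cW') zL.
  move=> x /(ses_exact cW')[y ->]; have [t ->] := ses_surj (ses_cover _) y.
  by have := z0 t; rewrite zero_lfunE !comp_lfunE.
have [e' eL eE] := H c cL.
by apply/coboundariesP; exists e' => //; apply/lfunP => x;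
  rewrite cE eE !comp_lfunE.
Qed.

(* [W] is an [m]-th syzygy of [Y] *)
Fixpoint resolves m Y W : Prop :=
  if m is m'.+1 then
    exists V, exists P, exists i : 'Hom(W, P), exists p : 'Hom(P, V),
      [/\ ses i p, projective P & resolves m' Y V]
  else W = Y.

Lemma resolves_std m X : resolves m X (iter m (@syzygy k A) X).
Proof.
elim: m => //= m IH; exists (iter m (@syzygy k A) X), (cover (iter m (@syzygy k
  A) X)).
exists (syzygy_incl _), (cover_map _); split=> //; first exact: ses_cover.
exact: cover_projective.
Qed.

End Resolutions.

(** * The Nakayama functor *)

Section Nakayama.
Local Open Scope ring_scope.
Variables (k : fieldType) (A : falgType k).
Implicit Types K L M N P U V W X Y Z I J : rmodule A.

Section Star.
Variable K : rmodule A.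

Fact star_act_subproof (a : A) (f : subvs_of (rhom K (rreg A))) :
  (amull a \o vsval f)%VF \in rhom K (rreg A).
Proof.
apply/rhomP; apply: (rlinear_comp (M := K) (N := rreg A) (P := rreg A)).
  exact: amull_rlinear.
exact/rhomP/subvsP.
Qed.

Definition star_act (a : A) (f : subvs_of (rhom K (rreg A))) :=
  Subvs (star_act_subproof a f).

Fact star_linearl f : linear (star_act^~ f).
Proof.
move=> c a b; apply/val_inj/lfunP => x.
rewrite /= add_lfunE scale_lfunE !comp_lfunE !lfunE /=.
by rewrite mulrDl scalerAl.
Qed.

Fact star_linearr a : linear (star_act a).
Proof.
move=> c f g; apply/val_inj/lfunP => x.
by rewrite /= add_lfunE scale_lfunE !comp_lfunE add_lfunE scale_lfunE linearP.
Qed.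

Fact star_act1 f : star_act 1 f = f.
Proof. by apply/val_inj/lfunP => x; rewrite /= comp_lfunE lfunE /= mul1r. Qed.

Fact star_actM a b f : star_act (a * b) f = star_act a (star_act b f).
Proof.
by apply/val_inj/lfunP => x; rewrite /= !comp_lfunE !lfunE /= mulrA.
Qed.

Definition star : lmodule A :=
  LModule star_linearl star_linearr star_act1 star_actM.

(* the Nakayama functor [D Hom_A(-, A)] *)
Definition nu : rmodule A := dual star.

(* a junk value unless [c] is rlinear *)
Definition nuev (phi : nu) (c : 'Hom(K, rreg A)) : k :=
  (phi : 'Hom(star, k^o)) (vsproj (rhom K (rreg A)) c).

(** Restricts to [Hom_A(K, A)] a functional given on all [k]-linear maps. With [nuev] and [nuout] it
    allows [nu K] to be handled without the subtype [subvs_of]. *)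
Definition nuin (psi : 'Hom('Hom(K, rreg A), k^o)) : nu :=
  (psi \o linfun vsval)%VF.

Lemma nuev_nuin psi c : rlinear c -> nuev (nuin psi) c = psi c.
Proof. by move=> /rhomP cL; rewrite /nuev comp_lfunE lfunE /= vsprojK. Qed.

Lemma nu_ext phi phi' :
  (forall c, rlinear c -> nuev phi c = nuev phi' c) -> phi = phi'.
Proof.
move=> e; apply/lfunP => f; have := e (vsval f).
by rewrite /nuev !vsvalK => -> //; apply/rhomP/subvsP.
Qed.

Lemma nuev_ract phi a c : rlinear c ->
  nuev (ract phi a) c = nuev phi (amull a \o c)%VF.
Proof.
move=> cL; rewrite /nuev.
rewrite -[ract phi a]/((phi : 'Hom(star, k^o)) \o linfun (lact (l := star)
  a))%VF.
rewrite comp_lfunE lfunE /=; congr (_ _).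
have /rhomP cL' := cL.
have /rhomP acL : rlinear (M := K) (N := rreg A) (amull a \o c)%VF.
  by apply: rlinear_comp cL; exact: amull_rlinear.
by apply: val_inj; rewrite /= !vsprojK.
Qed.

Lemma nuevP a phi phi' c : nuev (a *: phi + phi') c = a * nuev phi c + nuev
  phi' c.
Proof. by rewrite /nuev add_lfunE scale_lfunE. Qed.

Lemma nuev_linear phi : linear (nuev phi : _ -> k^o).
Proof. by move=> a c c'; rewrite /nuev !linearP. Qed.

Definition nuout phi : 'Hom('Hom(K, rreg A), k^o) := hom_of (nuev_linear phi).

Lemma nuoutE phi c : nuout phi c = nuev phi c.
Proof. exact: hom_ofE. Qed.

Lemma nuev0 c : nuev 0 c = 0.
Proof. by rewrite /nuev zero_lfunE. Qed.

End Star.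

Section Map.
Variables (K K' : rmodule A) (f : 'Hom(K, K')).

Definition numap_fun (phi : nu K) : nu K' :=
  nuin (nuout phi \o linfun (precomp (W := rreg A) f))%VF.

Fact numap_linear : linear numap_fun.
Proof.
move=> a x y; apply: nu_ext => c cL.
by rewrite nuevP !nuev_nuin // !comp_lfunE !nuoutE nuevP.
Qed.

Definition numap : 'Hom(nu K, nu K') := hom_of numap_linear.

Lemma numapE phi c : rlinear c -> nuev (numap phi) c = nuev phi (c \o f)%VF.
Proof.
by move=> cL; rewrite hom_ofE nuev_nuin // comp_lfunE nuoutE lfunE.
Qed.

Lemma numap_rlinear : rlinear f -> rlinear numap.
Proof.
move=> fL x a; apply: nu_ext => c cL.
rewrite numapE // !nuev_ract //; last exact: rlinear_comp.
rewrite numapE ?comp_lfunA //.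
by apply: rlinear_comp cL; exact: amull_rlinear.
Qed.

End Map.

Lemma numap_comp K K' K'' (g : 'Hom(K', K'')) (f : 'Hom(K, K')) phi :
  rlinear g -> numap g (numap f phi) = numap (g \o f)%VF phi.
Proof.
move=> gL; apply: nu_ext => c cL; rewrite !numapE ?comp_lfunA //.
exact: rlinear_comp.
Qed.

Lemma numap_id K phi : numap (\1 : 'Hom(K, K))%VF phi = phi.
Proof. by apply: nu_ext => c cL; rewrite numapE // comp_lfun1r. Qed.

Lemma numapP K K' (f g : 'Hom(K, K')) a phi :
  numap (a *: f + g) phi = a *: numap f phi + numap g phi.
Proof.
apply: nu_ext => c cL; rewrite nuevP !numapE // comp_lfunDr -comp_lfunZr.
by rewrite /nuev !linearP.
Qed.

Lemma numap0 K K' phi : numap (0 : 'Hom(K, K')) phi = 0.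
Proof.
apply: nu_ext => c cL; rewrite numapE // comp_lfun0r /nuev linear0 linear0.
by rewrite zero_lfunE.
Qed.

(* The rank one morphisms [p |-> z * c(p)], which span [Hom_A(P, Z)] for
   projective [P]. *)
Definition rank1 P Z (z : Z) (c : 'Hom(P, rreg A)) : 'Hom(P, Z) :=
  (linfun (ract z : A -> Z) \o c)%VF.

Lemma rank1E P Z (z : Z) (c : 'Hom(P, rreg A)) x : rank1 z c x = ract z (c x).
Proof. by rewrite comp_lfunE lfunE. Qed.

Lemma rank1_rlinear P Z (z : Z) (c : 'Hom(P, rreg A)) :
  rlinear c -> rlinear (rank1 z c).
Proof. by move=> cL x a; rewrite !rank1E cL -ractM. Qed.

(** The free cover of [P] splits; the [c a] are the coordinates of a section and the [p a] the
    images of the free generators. *)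
Lemma dual_basis P : projective P ->
  exists r, exists p : 'I_r -> P, exists c : 'I_r -> 'Hom(P, rreg A),
    (forall a, rlinear (c a)) /\ forall x, x = \sum_a ract (p a) (c a x).
Proof.
move=> prP; have [s sL sE] := projective_lift prP (@cover_map_rlinear _ _ P)
  (@rlinear1 _ _ P) (ses_surj (ses_cover P)).
have eL i : linear (fun x : cover P => x i : rreg A).
  by move=> a x y; rewrite !ffunE.
exists (\dim {:P}), (fun i => (vbasis {:P})`_i).
exists (fun i => (hom_of (eL i) \o s)%VF); split=> [i x a | x].
  by rewrite !comp_lfunE !hom_ofE sL ffunE.
have := sE x; rewrite id_lfunE lfunE /= /cover_fun => {1}<-.
by apply: eq_bigr => i _; rewrite comp_lfunE hom_ofE.
Qed.

Lemma rank1_span P Z (f : 'Hom(P, Z)) : projective P -> rlinear f ->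
  exists r, exists z : 'I_r -> Z, exists c : 'I_r -> 'Hom(P, rreg A),
    (forall a, rlinear (c a)) /\ f = \sum_a rank1 (z a) (c a).
Proof.
move=> prP fL; have [r [p [c [cL cE]]]] := dual_basis prP.
exists r, (fun a => f (p a)), c; split=> //; apply/lfunP => x.
rewrite {1}[x]cE linear_sum sum_lfunE; apply: eq_bigr => a _.
by rewrite rank1E /= fL.
Qed.

(** One half of the duality [Hom(Z, nu P) = D Hom(P, Z)]: the functional is
    [f |-> \sum_a nuev (g (f (p a))) (c a)] for a dual basis [p], [c] of [P]. *)
Lemma functional_of_hom P Z (g : 'Hom(Z, nu P)) : projective P -> rlinear g ->
  exists phi : 'Hom('Hom(P, Z), k^o),
    forall z c, rlinear c -> phi (rank1 z c) = nuev (g z) c.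
Proof.
move=> prP gL; have [r [p [c [cL cE]]]] := dual_basis prP.
have phiL : linear (fun f : 'Hom(P, Z) => \sum_a nuev (g (f (p a))) (c a) :
  k^o).
  move=> b f f'; rewrite scaler_sumr -big_split; apply: eq_bigr => a _.
  by rewrite add_lfunE scale_lfunE linearP nuevP.
exists (hom_of phiL) => z d dL; rewrite hom_ofE.
have -> : d = \sum_a (amull (d (p a)) \o c a)%VF.
  apply/lfunP => x; rewrite {1}[x]cE linear_sum sum_lfunE.
  by apply: eq_bigr => a _; rewrite /= dL comp_lfunE lfunE.
rewrite -nuoutE linear_sum; apply: eq_bigr => a _ /=.
rewrite nuoutE rank1E gL nuev_ract //.
congr (nuev _ (amull _ \o _)%VF).
rewrite sum_lfunE {2}[p a]cE linear_sum; apply: eq_bigr => b _.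
by rewrite /= comp_lfunE lfunE dL.
Qed.

(** The other half of the duality: [g z] sends [c] to the value of [psi] at [rank1 z c]. *)
Lemma hom_of_functional P Z (psi : 'Hom('Hom(P, Z), k^o)) :
  exists2 g : 'Hom(Z, nu P), rlinear g &
    forall z c, rlinear c -> nuev (g z) c = psi (rank1 z c).
Proof.
have cL z : linear (fun c : 'Hom(P, rreg A) => psi (rank1 z c)).
  move=> a c c'; rewrite -linearP; congr (psi _); apply/lfunP => x.
  by rewrite add_lfunE scale_lfunE !rank1E add_lfunE scale_lfunE linearP.
have gL : linear (fun z => nuin (hom_of (cL z))).
  move=> a z z'; apply: nu_ext => c cl.
  have rE : rank1 (a *: z + z') c = a *: rank1 z c + rank1 z' c.
    by apply/lfunP => x; rewrite add_lfunE scale_lfunE !rank1E ract_linearl.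
  by rewrite nuevP !nuev_nuin // !hom_ofE rE linearP.
exists (hom_of gL) => [z a|z c cl]; last by rewrite hom_ofE nuev_nuin ?hom_ofE.
apply: nu_ext => c cl; rewrite nuev_ract // !hom_ofE !nuev_nuin //; last first.
  by apply: rlinear_comp cl; exact: amull_rlinear.
rewrite !hom_ofE; congr (psi _); apply/lfunP => x.
rewrite !rank1E; exact/esym/ractM.
Qed.

End Nakayama.

(** * Lifting properties and full faithfulness of the Nakayama functor *)

Section NakayamaDuality.
Local Open Scope ring_scope.
Variables (k : fieldType) (A : falgType k).
Implicit Types F K L M N P U V W X Y Z I J : rmodule A.

Lemma rank1_precomp P P' Z (h : 'Hom(P', P)) (z : Z) (c : 'Hom(P, rreg A)) :
  rank1 z (c \o h)%VF = (rank1 z c \o h)%VF.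
Proof. by rewrite /rank1 comp_lfunA. Qed.

Definition proj_factored K Z (f : 'Hom(K, Z)) : Prop :=
  exists F, exists i : 'Hom(K, F), exists e : 'Hom(F, Z),
    [/\ projective F, rlinear i, rlinear e & forall x, f x = e (i x)].

(** By duality [g] is a functional on [Hom(P, Z)], to be factored through precomposition with [d]. A
    map killed by [d] factors through [p] and then through a projective, so it is a sum of rank one
    maps, on which the functional vanishes because [numap p] kills [g]. *)
Lemma nu_lift P P' K Z (d : 'Hom(P', P)) (p : 'Hom(P, K)) (g : 'Hom(Z, nu P)) :
  projective P -> rlinear d -> rlinear p -> (forall y, exists x, y = p x) ->
  (forall x, p x = 0 -> exists y, x = d y) ->
  (forall f : 'Hom(K, Z), rlinear f -> proj_factored f) ->
  rlinear g -> (forall z, numap p (g z) = 0) ->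
  exists2 g' : 'Hom(Z, nu P'), rlinear g' & forall z, numap d (g' z) = g z.
Proof.
move=> prP dL pL p_surj pd fac gL g0.
have [phi phiE] := functional_of_hom prP gL.
have [f /rhomP fL | psi psiE] := functional_factor (h := linfun (precomp (W :=
  Z) d))
  (S := rhom P Z) (phi := phi).
  rewrite lfunE /= => /lfunP f0.
  have [x px0|f' f'L f'E] := factor_through_surj pL p_surj fL.
    have [y ->] := pd x px0; have := f0 y.
    by rewrite comp_lfunE zero_lfunE.
  have [F [i [e [prF iL eL eE]]]] := fac f' f'L.
  have [r [z [c [cL cE]]]] := rank1_span prF eL.
  have -> : f = \sum_a rank1 (z a) (c a \o i \o p)%VF.
    apply/lfunP => x; rewrite f'E eE cE !sum_lfunE.
    by apply: eq_bigr => a _; rewrite !rank1E !comp_lfunE.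
  rewrite linear_sum big1 // => a _ /=.
  have ciL := rlinear_comp (cL a) iL.
  rewrite phiE; last exact: rlinear_comp pL.
  by rewrite -numapE // g0 nuev0.
have [g' g'L g'E] := hom_of_functional psi; exists g' => // z.
apply: nu_ext => c cL; rewrite numapE // g'E; last exact: rlinear_comp.
have := psiE (rank1 z c); rewrite lfunE /= rank1_precomp => ->.
  exact: phiE.
exact/rhomP/rank1_rlinear.
Qed.

Lemma nu_injective P : projective P -> injective_mod (nu P).
Proof.
move=> prP Z c cL; set i := syzygy_incl Z.
have [phi phiE] := functional_of_hom prP cL.
have hL : linear (fun f : 'Hom(P, syzygy Z) => (i \o f)%VF).
  by move=> a f g; rewrite comp_lfunDr -comp_lfunZr.
have [f _ | psi psiE] := functional_factor (h := hom_of hL) (S := fullv) (phi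
  := phi).
  rewrite hom_ofE => /lfunP f0; suff -> : f = 0 by rewrite linear0.
  apply/lfunP => x; rewrite zero_lfunE; apply: (ses_inj (ses_cover Z)).
  by have := f0 x; rewrite comp_lfunE zero_lfunE.
have [e eL eE] := hom_of_functional psi; exists e => // u.
apply: nu_ext => d dL; rewrite eE //.
have -> : rank1 (i u) d = hom_of hL (rank1 u d).
  rewrite hom_ofE; apply/lfunP => x; rewrite comp_lfunE !rank1E.
  by rewrite (ses_rlinear_i (ses_cover Z)).
by rewrite psiE ?memvf // phiE.
Qed.

(** A functional that separates [f] from the maps factoring through [h'] amounts to a map
    [Z -> nu F] killed by [numap h']. Its lift to [nu F0] shows that the functional vanishes at [f],
    since [f \o h = 0]. *)
Lemma nu_colift F0 F F' Z (h : 'Hom(F0, F)) (h' : 'Hom(F, F')) (f : 'Hom(F, Z))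
  :
  projective F0 -> projective F -> rlinear h -> rlinear h' ->
  (forall g : 'Hom(Z, nu F), rlinear g -> (forall z, numap h' (g z) = 0) ->
     exists2 g' : 'Hom(Z, nu F0), rlinear g' & forall z, numap h (g' z) = g z)
       ->
  rlinear f -> (forall x, f (h x) = 0) ->
  exists2 e : 'Hom(F', Z), rlinear e & forall x, f x = e (h' x).
Proof.
move=> prF0 prF hL h'L lift fL fh0.
pose S : {vspace 'Hom(F, Z)} := (linfun (precomp (W := Z) h') @: rhom F' Z)%VS.
have [fS | /functional_sep[phi phi0]] := boolP (f \in S).
  have /memv_imgP[e /rhomP eL fE] := fS; exists e => // x.
  by rewrite fE lfunE /= comp_lfunE.
case/negP; have [g gL gE] := hom_of_functional phi.
have [z|g' g'L g'E] := lift g gL.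
  apply: nu_ext => c cL; rewrite numapE // nuev0 gE; last exact: rlinear_comp.
  rewrite rank1_precomp phi0 //; apply/memv_imgP; exists (rank1 z c).
    exact/rhomP/rank1_rlinear.
  by rewrite lfunE.
have [phi' phi'E] := functional_of_hom prF0 g'L.
have [r [z [c [cL fE]]]] := rank1_span prF fL.
have phiE : phi f = phi' (f \o h)%VF.
  rewrite {1}fE linear_sum.
  have -> : (f \o h)%VF = \sum_a rank1 (z a) (c a \o h)%VF.
    apply/lfunP => x; rewrite comp_lfunE fE !sum_lfunE.
    by apply: eq_bigr => a _; rewrite !rank1E comp_lfunE.
  rewrite linear_sum; apply: eq_bigr => a _ /=.
  rewrite phi'E; last exact: rlinear_comp.
  by rewrite -numapE // g'E gE.
rewrite phiE; suff -> : (f \o h)%VF = 0 by rewrite linear0.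
by apply/lfunP => x; rewrite comp_lfunE fh0 zero_lfunE.
Qed.

Lemma double_dual (V : vectType k) (alpha : 'Hom('Hom(V, k^o), k^o)) :
  exists v, forall psi, alpha psi = psi v.
Proof.
have cL i : linear (fun v => coord (vbasis {:V}) i v : k^o).
  by move=> a x y; rewrite linearP.
exists (\sum_(i < \dim {:V}) alpha (hom_of (cL i)) *: (vbasis {:V})`_i) => psi.
have {1}-> : psi = \sum_(i < \dim {:V}) psi (vbasis {:V})`_i *: hom_of (cL i).
  apply/lfunP => x; rewrite {1}(coord_vbasis (memvf x)) linear_sum sum_lfunE.
  apply: eq_bigr => i _; rewrite scale_lfunE hom_ofE linearZ /=.
  by rewrite -![_ *: _]/(_ * _) mulrC.
rewrite !linear_sum; apply: eq_bigr => i _.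
by rewrite !linearZ /= -![_ *: _]/(_ * _) mulrC.
Qed.

(** Double duality gives a [k]-linear [v]; it lies in [Hom_A(K, A)] because functionals vanishing on
    that subspace become zero in [nu K]. *)
Lemma nu_functional K (alpha : 'Hom(nu K, k^o)) :
  exists2 v : 'Hom(K, rreg A), rlinear v & forall phi, alpha phi = nuev phi v.
Proof.
have nL : linear (fun psi => nuin psi : nu K).
  by move=> a x y; apply: nu_ext => c cL;
    rewrite nuevP !nuev_nuin // add_lfunE scale_lfunE.
have [v vE] := double_dual (alpha \o hom_of nL)%VF.
have vL : v \in rhom K (rreg A).
  apply: contraT => /functional_sep[psi psi0]; case/negP.
  have := vE psi; rewrite comp_lfunE hom_ofE => <-.
  suff -> : nuin psi = 0 by rewrite linear0.
  by apply: nu_ext => c cL; rewrite nuev_nuin // nuev0 psi0 //; apply/rhomP.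
exists v; first exact/rhomP.
move=> phi; have := vE (nuout phi); rewrite comp_lfunE hom_ofE nuoutE => <-.
congr (alpha _); apply: nu_ext => c cL; by rewrite nuev_nuin // nuoutE.
Qed.

Lemma nu_faithful F P (f : 'Hom(F, P)) : projective P -> rlinear f ->
  (forall phi, numap f phi = 0) -> f = 0.
Proof.
move=> prP fL f0; have [r [p [c [cL cE]]]] := dual_basis prP.
have cf0 a : (c a \o f)%VF = 0.
  have [|/functional_sep[psi _]] := boolP ((c a \o f)%VF \in (0%VS : {vspace
    _})).
    by rewrite memv0 => /eqP.
  case/negP; rewrite -nuev_nuin; last exact: rlinear_comp.
  by rewrite -numapE // f0 nuev0.
apply/lfunP => x; rewrite [f x]cE zero_lfunE big1 // => a _.
by rewrite -comp_lfunE cf0 zero_lfunE linear0.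
Qed.

(** For a dual basis [p], [c] of [P], the functional [phi |-> nuev (g phi) (c a)] is evaluation at
    some [d a : F -> A]; then [h] is the sum of the [rank1 (p a) (d a)]. *)
Lemma nu_full F P (g : 'Hom(nu F, nu P)) : projective P -> rlinear g ->
  exists2 h : 'Hom(F, P), rlinear h & forall phi, g phi = numap h phi.
Proof.
move=> prP gL; have [r [p [c [cL cE]]]] := dual_basis prP.
have dual_of a : exists d : 'Hom(F, rreg A),
    rlinear d /\ forall phi, nuev (g phi) (c a) = nuev phi d.
  have aL : linear (fun phi => nuev (g phi) (c a) : k^o).
    by move=> b x y; rewrite linearP nuevP.
  have [d dL dE] := nu_functional (hom_of aL).
  by exists d; split=> // phi; rewrite -dE hom_ofE.
have [d dP] : exists d : 'I_r -> 'Hom(F, rreg A), forall a,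
    rlinear (d a) /\ forall phi, nuev (g phi) (c a) = nuev phi (d a).
  have [d dP] := fin_all_exists dual_of; by exists d.
pose h : 'Hom(F, P) := \sum_a rank1 (p a) (d a).
have hE x : h x = \sum_a ract (p a) (d a x).
  by rewrite sum_lfunE; apply: eq_bigr => a _; rewrite rank1E.
exists h => [x a|phi].
  rewrite !hE ract_suml; apply: eq_bigr => b _.
  by rewrite (dP b).1 ractM.
apply: nu_ext => e eL; rewrite numapE //.
have -> : (e \o h)%VF = \sum_a (amull (e (p a)) \o d a)%VF.
  apply/lfunP => x; rewrite comp_lfunE hE linear_sum sum_lfunE.
  by apply: eq_bigr => a _; rewrite /= eL comp_lfunE lfunE.
have {1}-> : e = \sum_a (amull (e (p a)) \o c a)%VF.
  apply/lfunP => x; rewrite {1}[x]cE linear_sum sum_lfunE.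
  by apply: eq_bigr => a _; rewrite /= eL comp_lfunE lfunE.
rewrite -!nuoutE !linear_sum; apply: eq_bigr => a _ /=.
rewrite !nuoutE -nuev_ract // -nuev_ract; last exact: (dP a).1.
by rewrite -gL (dP a).2.
Qed.

(** With [r] the dimension of [L], [x] goes to the functional that sums the [i]-th coordinates of
    [x * c(e i)]; its values at the coordinate projections of [A^r] are the coordinates of [x],
    whence injectivity. *)
Lemma nu_embed L : exists r, exists2 i : 'Hom(L, nu (rfree A r)),
  rlinear i & forall x, i x = 0 -> x = 0.
Proof.
pose r := \dim {:L}; pose lam (i : 'I_r) (x : L) : k := coord (vbasis {:L}) i x.
have lamP i a x y : lam i (a *: x + y) = a * lam i x + lam i y.
  by rewrite /lam linearP.
pose e (i : 'I_r) : rfree A r := [ffun j => (i == j)%:R].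
have sL x : linear (fun c : 'Hom(rfree A r, rreg A) =>
    \sum_i lam i (ract x (c (e i) : A)) : k^o).
  move=> a c c'; rewrite scaler_sumr -big_split; apply: eq_bigr => i _ /=.
  by rewrite add_lfunE scale_lfunE ract_linearr lamP.
have iL : linear (fun x => nuin (hom_of (sL x))).
  move=> a x y; apply: nu_ext => c cL; rewrite nuevP !nuev_nuin // !hom_ofE.
  rewrite mulr_sumr -big_split; apply: eq_bigr => i _ /=.
  by rewrite ract_linearl lamP.
exists r, (hom_of iL) => [x a|x x0].
  apply: nu_ext => c cL; rewrite nuev_ract // !hom_ofE !nuev_nuin //;
    last first.
    by apply: rlinear_comp cL; exact: amull_rlinear.
  rewrite !hom_ofE; apply: eq_bigr => i _.
  by rewrite comp_lfunE [amull _ _]lfunE /= ractM.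
rewrite (coord_vbasis (memvf x)) big1 // => i _.
have prL : linear (fun y : rfree A r => y i : rreg A).
  by move=> a y z; rewrite !ffunE.
have pr_rlinear : rlinear (hom_of prL) by move=> y a; rewrite !hom_ofE ffunE.
have : nuev (hom_of iL x) (hom_of prL) = 0 by rewrite x0 nuev0.
rewrite hom_ofE nuev_nuin // hom_ofE (bigD1 i) //= big1 ?addr0.
  by rewrite hom_ofE ffunE eqxx ract1 /lam => ->; rewrite scale0r.
move=> j /negPf ji; rewrite hom_ofE ffunE ji /lam.
by rewrite (linear0 (ract x)) linear0.
Qed.

Lemma injective_ses L : exists r, exists J, exists i : 'Hom(L, nu (rfree A r)),
  exists p : 'Hom(nu (rfree A r), J), ses i p.
Proof.
have [r [i iL i_inj]] := nu_embed L; have [J [p ip]] := ses_cokernel iL i_inj.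
by exists r, J, i, p.
Qed.

Lemma nu_rfree_injective r : injective_mod (nu (rfree A r)).
Proof. exact/nu_injective/rfree_projective. Qed.

(** Independence of the resolution: a syzygy step is traded for a cosyzygy of [L], the induction
    hypothesis applies to [V], and the step is traded back along the free cover. *)
Lemma resolves_E1 m Y W L : resolves m Y W ->
  (E1 W L <-> E1 (iter m (@syzygy k A) Y) L).
Proof.
elim: m Y W L => [|m IH] Y W L /=; first by move->.
case=> V [P [i [p [ip prP VY]]]].
have [r [J [j [q jq]]]] := injective_ses L.
have injI := @nu_rfree_injective r.
apply: iff_trans (E1_shift ip prP jq injI) _; apply: iff_trans (IH _ _ _ VY) _.
apply: iff_sym.
exact: (E1_shift (ses_cover _) (@cover_projective _ _ _) jq injI).
Qed.

Lemma E1_shift_iter m X L I J (j : 'Hom(L, I)) (q : 'Hom(I, J)) :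
  ses j q -> injective_mod I ->
  (E1 (iter m.+1 (@syzygy k A) X) L <-> E1 (iter m (@syzygy k A) X) J).
Proof.
move=> jq injI.
exact: (E1_shift (ses_cover _) (@cover_projective _ _ _) jq injI).
Qed.

End NakayamaDuality.

(** * Stable retracts and the translate *)

Section Translate.
Local Open Scope ring_scope.
Variables (k : fieldType) (A : falgType k).
Implicit Types E F K L M N P T U V W X Y Z I J G : rmodule A.

Local Notation syz := (@syzygy k A).

(** In a resolution of length [n] the last term is an [n]-th syzygy; being projective it has no
    [Ext^1], and [resolves_E1] passes to the standard syzygy. *)
Lemma gldim_E1 n X L : gldim_le A n -> E1 (iter n syz X) L.
Proof.
move=> /(_ X)[R R0].
(* [K] is the [i]-th syzygy in the given resolution, with an epimorphism [p] from [R i] whose kernel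
   is the image of the next differential. *)
have step i : exists K, exists2 p : 'Hom(R i, K),
    rlinear p /\ (forall y, exists x, y = p x) &
    resolves i X K /\ forall x, p x = 0 <-> exists y, x = res_d R i y.
  elim: i => [|i [K [p [pL p_surj] [XK pE]]]].
    exists X, (res_aug R); split=> //=.
    - exact: res_aug_rlinear.
    - exact/limg_fullP/res_aug_surj.
    move=> x; split=> [/eqP | [y ->]].
      by rewrite -memv_ker -res_exact0 => /memv_imgP[y _ ->]; exists y.
    by apply/eqP; rewrite -memv_ker -res_exact0 memv_img ?memvf.
  have [K' [j jp]] := ses_kernel pL p_surj.
  have dL := @res_d_rlinear _ _ _ R i.
  have [x|p' p'L p'E] := ses_lift jp dL; first by apply/pE; exists x.
  exists K', p'; split=> //.
  - move=> y; have /pE[x xE] := ses_comp jp y; exists x.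
    by apply/eqP; rewrite -subr_eq0; apply/eqP/(ses_inj jp);
      rewrite linearB /= -p'E xE subrr.
  - by exists K, (R i), j, p; split=> //; exact: res_proj.
  move=> x; split=> [px0|[y ->]].
    have : x \in lker (res_d R i) by rewrite memv_ker p'E px0 linear0.
    by rewrite -res_exact => /memv_imgP[y _ ->]; exists y.
  apply: (ses_inj jp); rewrite -p'E; apply/eqP.
  by rewrite -memv_ker -res_exact memv_img ?memvf.
have [K [p [pL p_surj] [XK pE]]] := step n.
apply/(resolves_E1 L XK).
apply: (@E1_of_proj _ _ (rzero A) (R n) _ _ 0 p).
- split=> //; first exact: rlinear0.
  + by move=> x _; apply/ffunP => - [].
  + by move=> x; rewrite zero_lfunE linear0.
  + move=> x /pE[y ->]; exists 0; rewrite (R0 n.+1 (ltnSn n) y).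
    by rewrite !linear0.
- exact: res_proj.
move=> c _; exists 0; first exact: rlinear0.
move=> x; have -> : x = 0 by apply/ffunP => - [].
by rewrite !linear0.
Qed.

(* [W] is a direct summand of [N1 + N2] in the stable category *)
Definition stable_retract W N1 N2 : Prop :=
  exists u1 : 'Hom(W, N1), exists u2 : 'Hom(W, N2),
  exists v1 : 'Hom(N1, W), exists v2 : 'Hom(N2, W),
  exists E : rmodule A, exists s : 'Hom(W, E), exists e : 'Hom(E, W),
    [/\ [/\ rlinear u1, rlinear u2, rlinear v1 & rlinear v2],
        [/\ projective E, rlinear s & rlinear e]
      & forall x, v1 (u1 x) + v2 (u2 x) = x + e (s x)].

Lemma ses_map K P W K' P' W' (i : 'Hom(K, P)) (p : 'Hom(P, W))
    (i' : 'Hom(K', P')) (p' : 'Hom(P', W')) (u : 'Hom(W, W')) :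
  ses i p -> projective P -> ses i' p' -> rlinear u ->
  exists U : 'Hom(P, P'), exists u' : 'Hom(K, K'),
    [/\ rlinear U, rlinear u', forall x, p' (U x) = u (p x)
      & forall x, i' (u' x) = U (i x)].
Proof.
move=> ip prP ip' uL.
have [U UL UE] := projective_lift prP (ses_rlinear_p ip')
  (rlinear_comp uL (ses_rlinear_p ip)) (ses_surj ip').
have [||u' u'L u'E] := ses_lift (f := (U \o i)%VF) ip'.
- exact: rlinear_comp (ses_rlinear_i ip).
- by move=> x; rewrite comp_lfunE UE comp_lfunE (ses_comp ip) linear0.
exists U, u'; split=> // x; first by rewrite UE comp_lfunE.
by rewrite -u'E comp_lfunE.
Qed.

(** All maps are lifted to the projectives, and the error [d] takes values in [K], which gives [s].
    The squares with [U] and [V] are kept because [translate_map] needs them. *)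
Lemma stable_retract_syz K P W K1 P1 N1 K2 P2 N2
    (i : 'Hom(K, P)) (p : 'Hom(P, W)) (i1 : 'Hom(K1, P1)) (p1 : 'Hom(P1, N1))
    (i2 : 'Hom(K2, P2)) (p2 : 'Hom(P2, N2)) :
  ses i p -> ses i1 p1 -> ses i2 p2 ->
  projective P -> projective P1 -> projective P2 -> stable_retract W N1 N2 ->
  exists u1 : 'Hom(K, K1), exists u2 : 'Hom(K, K2),
  exists v1 : 'Hom(K1, K), exists v2 : 'Hom(K2, K), exists s : 'Hom(P, K),
  [/\ [/\ rlinear u1, rlinear u2, rlinear v1, rlinear v2 & rlinear s],
      exists2 U : 'Hom(P, P1), rlinear U & (i1 \o u1)%VF = (U \o i)%VF,
      exists2 U : 'Hom(P, P2), rlinear U & (i2 \o u2)%VF = (U \o i)%VF,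
      (exists2 V : 'Hom(P1, P), rlinear V & (i \o v1)%VF = (V \o i1)%VF) /\
      (exists2 V : 'Hom(P2, P), rlinear V & (i \o v2)%VF = (V \o i2)%VF)
    & forall x, v1 (u1 x) + v2 (u2 x) = x + s (i x)].
Proof.
move=> ip ip1 ip2 prP prP1 prP2.
case=> [u1 [u2 [v1 [v2 [E [s [e [[u1L u2L v1L v2L] [prE sL eL] sum]]]]]]]].
have [U1 [w1 [U1L w1L U1E w1E]]] := ses_map ip prP ip1 u1L.
have [U2 [w2 [U2L w2L U2E w2E]]] := ses_map ip prP ip2 u2L.
have [V1 [y1 [V1L y1L V1E y1E]]] := ses_map ip1 prP1 ip v1L.
have [V2 [y2 [V2L y2L V2E y2E]]] := ses_map ip2 prP2 ip v2L.
have [E' E'L E'E] := projective_lift prE (ses_rlinear_p ip) eL (ses_surj ip).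
pose d : 'Hom(P, P) := ((V1 \o U1) + (V2 \o U2) - \1 - (E' \o s \o p))%VF.
have dE x : d x = V1 (U1 x) + V2 (U2 x) - x - E' (s (p x)).
  by rewrite /d !add_lfunE !opp_lfunE !comp_lfunE id_lfunE.
have dL : rlinear d.
  have pL := ses_rlinear_p ip.
  apply: rlinearB; last by apply: rlinear_comp => //; exact: rlinear_comp.
  apply: rlinearB; last exact: rlinear1.
  by apply: rlinearD; exact: rlinear_comp.
have [|t tL tE] := ses_lift ip dL.
  move=> x; rewrite dE !linearB linearD /= V1E V2E U1E U2E sum E'E.
  by rewrite [_ + e _]addrC addrK subrr.
exists w1, w2, y1, y2, t; split=> //.
- by exists U1 => //; apply/lfunP => x; rewrite !comp_lfunE.
- by exists U2 => //; apply/lfunP => x; rewrite !comp_lfunE.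
- split; first by exists V1 => //; apply/lfunP => x; rewrite !comp_lfunE.
  by exists V2 => //; apply/lfunP => x; rewrite !comp_lfunE.
move=> x; apply: (ses_eq ip).
rewrite !linearD /= -tE dE (ses_comp ip) !linear0 addr0 y1E y2E w1E w2E.
by rewrite [RHS]addrC subrK.
Qed.

Lemma stable_retract_resolves m W N1 N2 K K1 K2 :
  resolves m W K -> resolves m N1 K1 -> resolves m N2 K2 ->
  stable_retract W N1 N2 -> stable_retract K K1 K2.
Proof.
elim: m W N1 N2 K K1 K2 => [|m IH] W N1 N2 K K1 K2 /=; first by move=> -> -> ->.
case=> [V [P [i [p [ip prP WV]]]]] [V1 [P1 [i1 [p1 [ip1 prP1 WV1]]]]].
case=> [V2 [P2 [i2 [p2 [ip2 prP2 WV2]]]]] /(IH _ _ _ _ _ _ WV WV1 WV2) st.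
have := stable_retract_syz ip ip1 ip2 prP prP1 prP2 st.
case=> [u1 [u2 [v1 [v2 [s [[u1L u2L v1L v2L sL] _ _ _ sum]]]]]].
exists u1, u2, v1, v2, P, i, s; split=> //; split=> //.
exact: ses_rlinear_i ip.
Qed.

(* For [K] the n-th syzygy of [X] and [i] its inclusion in the projective [P],
   this characterizes [T = tau_n X]. *)
Definition is_translate K P (i : 'Hom(K, P)) T : Prop :=
  exists j : 'Hom(T, nu K), [/\ rlinear j, forall x, j x = 0 -> x = 0
    & forall phi, numap i phi = 0 <-> exists t, phi = j t].

Lemma translate_map K P K' P' T T' (i : 'Hom(K, P)) (i' : 'Hom(K', P'))
    (j : 'Hom(T, nu K)) (j' : 'Hom(T', nu K')) (u : 'Hom(K, K')) (U : 'Hom(P,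
      P')) :
  rlinear j -> (forall t, numap i (j t) = 0) ->
  rlinear j' -> (forall x, j' x = 0 -> x = 0) ->
  (forall phi, numap i' phi = 0 <-> exists t, phi = j' t) ->
  rlinear i' -> rlinear U -> rlinear u -> (i' \o u)%VF = (U \o i)%VF ->
  exists2 t : 'Hom(T, T'), rlinear t & forall x, numap u (j x) = j' (t x).
Proof.
move=> jL j0 j'L j'_inj j'E i'L UL uL comm.
have [||t tL tE] := lift_along_inj (f := (numap u \o j)%VF) j'L j'_inj.
- exact: rlinear_comp (numap_rlinear uL) jL.
- move=> z; rewrite comp_lfunE; apply/j'E.
  by rewrite numap_comp // comm -numap_comp // j0 linear0.
by exists t => // x; rewrite -tE comp_lfunE.
Qed.

(** This makes [X] a direct summand of [dsum N1 N2], in terms of components. *)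
Definition retract X N1 N2 : Prop :=
  exists u1 : 'Hom(X, N1), exists u2 : 'Hom(X, N2),
  exists v1 : 'Hom(N1, X), exists v2 : 'Hom(N2, X),
  [/\ rlinear u1, rlinear u2, rlinear v1, rlinear v2
    & forall x, v1 (u1 x) + v2 (u2 x) = x].

Lemma numapD K K' (f g : 'Hom(K, K')) phi :
  numap (f + g) phi = numap f phi + numap g phi.
Proof. by rewrite -{1}(scale1r f) numapP scale1r. Qed.

(** On the kernel of [numap i] the error term [s \o i] acts as zero, so a stable retract becomes a
    genuine one. *)
Lemma translate_retract K P W K1 P1 N1 K2 P2 N2 T T1 T2
    (i : 'Hom(K, P)) (p : 'Hom(P, W)) (i1 : 'Hom(K1, P1)) (p1 : 'Hom(P1, N1))
    (i2 : 'Hom(K2, P2)) (p2 : 'Hom(P2, N2)) :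
  ses i p -> ses i1 p1 -> ses i2 p2 ->
  projective P -> projective P1 -> projective P2 -> stable_retract W N1 N2 ->
  is_translate i T -> is_translate i1 T1 -> is_translate i2 T2 ->
  retract T T1 T2.
Proof.
move=> ip ip1 ip2 prP prP1 prP2 st [j [jL j_inj jE]] [j1 [j1L j1_inj j1E]].
case=> [j2 [j2L j2_inj j2E]].
have [u1 [u2 [v1 [v2 [s [[u1L u2L v1L v2L sL]]]]]]] :=
  stable_retract_syz ip ip1 ip2 prP prP1 prP2 st.
case=> [U1 U1L U1E] [U2 U2L U2E] [[V1 V1L V1E] [V2 V2L V2E]] sum.
have j0 t : numap i (j t) = 0 by apply/jE; exists t.
have j10 t : numap i1 (j1 t) = 0 by apply/j1E; exists t.
have j20 t : numap i2 (j2 t) = 0 by apply/j2E; exists t.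
have iL := ses_rlinear_i ip; have i1L := ses_rlinear_i ip1.
have i2L := ses_rlinear_i ip2.
have [a1 a1L a1E] := translate_map jL j0 j1L j1_inj j1E i1L U1L u1L U1E.
have [a2 a2L a2E] := translate_map jL j0 j2L j2_inj j2E i2L U2L u2L U2E.
have [b1 b1L b1E] := translate_map j1L j10 jL j_inj jE iL V1L v1L V1E.
have [b2 b2L b2E] := translate_map j2L j20 jL j_inj jE iL V2L v2L V2E.
exists a1, a2, b1, b2; split=> // x.
apply/eqP; rewrite -subr_eq0; apply/eqP/j_inj; rewrite linearB linearD /=.
rewrite -b1E -b2E -a1E -a2E !numap_comp // -numapD.
have -> : ((v1 \o u1) + (v2 \o u2) = \1 + (s \o i))%VF.
  by apply/lfunP => y; rewrite !add_lfunE !comp_lfunE id_lfunE sum.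
by rewrite numapD numap_id -numap_comp // j0 linear0 addr0 subrr.
Qed.

Lemma retract_stable X N1 N2 : retract X N1 N2 -> stable_retract X N1 N2.
Proof.
case=> [u1 [u2 [v1 [v2 [u1L u2L v1L v2L sum]]]]].
exists u1, u2, v1, v2, (rzero A), 0, 0; split=> //.
  by split; [exact: rfree_projective|exact: rlinear0|exact: rlinear0].
by move=> x; rewrite sum !zero_lfunE addr0.
Qed.

Lemma dual_ractE (Q : lmodule A) (f : dual Q) a x :
  (ract f a : 'Hom(Q, k^o)) x = (f : 'Hom(Q, k^o)) (lact a x).
Proof.
rewrite -[ract f a]/((f : 'Hom(Q, k^o)) \o linfun (lact (l := Q) a))%VF.
by rewrite comp_lfunE lfunE.
Qed.

(** The kernel of [nu K -> nu P] is dual to the cokernel of [Hom(P, A) -> Hom(K, A)], which is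
    [Ext^(m+1)(X, A)]. *)
Lemma tau_translate m X :
  is_translate (syzygy_incl (iter m syz X)) (tau m.+1 X).
Proof.
set W := iter m syz X; pose K := syzygy W; pose p := cover_map K.
have cW : ses (syzygy_incl W) (cover_map W) := ses_cover W.
have cK : ses (syzygy_incl K) p := ses_cover K.
have pL := ses_rlinear_p cK.
pose R := std_resolution X.
have cpZ (c : 'Hom(K, rreg A)) : rlinear c ->
    ((c \o p)%VF : 'Hom(R m.+1, rreg A)) \in cocycles R (rreg A) m.+1.
  move=> cL; apply/cocyclesP; split; first exact: rlinear_comp.
  by apply/lfunP => x; rewrite zero_lfunE !comp_lfunE (ses_comp cK) linear0.
have class_lin : linear (fun c : 'Hom(K, rreg A) =>
    Ext_class ((c \o p)%VF : 'Hom(R m.+1, rreg A))).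
  move=> a c c'; rewrite /Ext_class -linearP; congr (vquot_pi _ _ _).
  by rewrite comp_lfunDl comp_lfunZl.
(* [cl] presents [Ext^(m+1)(X, A)] as the quotient of [Hom_A(K, A)] by the maps that extend to
   [cover W]. *)
pose cl := hom_of class_lin.
have sBZ := sub_coboundaries R (rreg A) m.+1.
have cl_eq0 c : rlinear c -> cl c = 0 <->
    exists2 e : 'Hom(cover W, rreg A), rlinear e & c = (e \o syzygy_incl W)%VF.
  move=> cL; rewrite hom_ofE; split=> [/eqP|[e eL ->]]; last first.
    apply/eqP; rewrite vquot_eq0 //.
      by apply/coboundariesP; exists e => //; rewrite comp_lfunA.
    by apply: cpZ; exact: rlinear_comp (ses_rlinear_i cW).
  rewrite vquot_eq0 //; last exact: cpZ.
  case/coboundariesP => e eL /lfunP cE; exists e => //; apply/lfunP => x.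
  have [y ->] := ses_surj cK x; have := cE y.
  by rewrite !comp_lfunE.
have cl_surj (q : Ext m.+1 X (rreg A)) : exists2 c, rlinear c & q = cl c.
  have [z zZ <-] := vquot_surj q; have /cocyclesP[zL /lfunP z0] := zZ.
  have [|c cL cE] := factor_through_surj pL (ses_surj cK) zL.
    move=> x /(ses_exact cK)[y ->]; have [t ->] := ses_surj (ses_cover _) y.
    by have := z0 t; rewrite zero_lfunE !comp_lfunE.
  exists c => //; rewrite hom_ofE; congr (vquot_pi _ _ _).
  by apply/lfunP => x; rewrite comp_lfunE cE.
have cl_act a c : rlinear c -> Ext_lact a (cl c) = cl (amull a \o c)%VF.
  move=> cL; rewrite !hom_ofE -comp_lfunA.
  exact: Ext_map_class (@amull_rlinear _ _ a) (cpZ c cL).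
pose tf (t : tau m.+1 X) : 'Hom(Ext m.+1 X (rreg A), k^o) := t.
have jL : linear (fun t : tau m.+1 X => nuin (tf t \o cl)%VF : nu K).
  move=> a x y; apply: nu_ext => c cL; rewrite nuevP !nuev_nuin // !comp_lfunE.
  by rewrite /tf add_lfunE scale_lfunE.
have jE t c : rlinear c -> nuev (hom_of jL t) c = tf t (cl c).
  by move=> cL; rewrite hom_ofE nuev_nuin // comp_lfunE.
exists (hom_of jL); split=> [t a|t t0|phi].
- apply: nu_ext => c cL; rewrite nuev_ract // !jE //; last first.
    by apply: rlinear_comp cL; exact: amull_rlinear.
  rewrite -cl_act // /tf.
  exact: (@dual_ractE (Ext_lmodule m.+1 X) t a).
- apply/lfunP => q; have [c cL ->] := cl_surj q.
  by rewrite -[t _]/(tf t _) -jE // t0 nuev0 zero_lfunE.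
split=> [phi0|[t ->]]; last first.
  apply: nu_ext => c cL; have ciL := rlinear_comp cL (ses_rlinear_i cW).
  rewrite numapE // jE // nuev0; have [_ ->] := cl_eq0 _ ciL.
    by rewrite linear0.
  by exists c.
have [c /rhomP cL /(cl_eq0 _ cL)[e eL ->]|psi psiE] :=
    functional_factor (h := cl) (S := rhom K (rreg A)) (phi := nuout phi).
  by rewrite nuoutE -numapE // phi0 nuev0.
exists psi; apply: nu_ext => c cL; rewrite jE // /tf psiE ?nuoutE //.
exact/rhomP.
Qed.

Lemma tau_retract m X N1 N2 :
  retract X N1 N2 -> retract (tau m.+1 X) (tau m.+1 N1) (tau m.+1 N2).
Proof.
move=> /retract_stable/(stable_retract_resolves (resolves_std m _)
  (resolves_std m _) (resolves_std m _)).
have tr := @tau_translate m; have c N := ses_cover (iter m syz N).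
move=> st; apply: translate_retract (c _) (c _) (c _) _ _ _ st (tr _) (tr _)
  (tr _).
all: exact: cover_projective.
Qed.

End Translate.

(** * Ext groups with values in the translate *)

Section ExtTau.
Local Open Scope ring_scope.
Variables (k : fieldType) (A : falgType k).
Implicit Types E F K L M N P T U V W X Y Z I J G : rmodule A.

Local Notation syz := (@syzygy k A).

(* [Ext^j(X, Z) = 0], with [Ext^0 = Hom] *)
Definition ExtV j X Z : Prop :=
  if j is j'.+1 then E1 (iter j' syz X) Z
  else forall f : 'Hom(X, Z), rlinear f -> f = 0.

Section NuSes.
Variables (K P W : rmodule A) (i : 'Hom(K, P)) (p : 'Hom(P, W)).
Hypothesis ip : ses i p.

Lemma nu_ses_surj phi : exists phi', phi = numap p phi'.
Proof.
have [c _ | psi psiE] := functional_factor (h := linfun (precomp (W := rreg A)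
  p))
    (S := fullv) (phi := nuout phi).
  rewrite lfunE /= => /lfunP c0; suff -> : c = 0 by rewrite linear0.
  apply/lfunP => y; have [x ->] := ses_surj ip y.
  by have := c0 x; rewrite comp_lfunE !zero_lfunE.
exists (nuin psi); apply: nu_ext => c cL; rewrite numapE // nuev_nuin.
  by have := psiE c (memvf _); rewrite lfunE nuoutE.
exact: rlinear_comp (ses_rlinear_p ip).
Qed.

Lemma nu_ses_exact phi : numap p phi = 0 -> exists phi', phi = numap i phi'.
Proof.
move=> phi0.
have [c /rhomP cL | psi psiE] := functional_factor (h := linfun (precomp (W :=
  rreg A) i))
    (S := rhom P (rreg A)) (phi := nuout phi).
  rewrite lfunE /= => /lfunP c0.
  have [x|d dL dE] := ses_desc ip cL.
    by have := c0 x; rewrite comp_lfunE zero_lfunE.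
  have -> : c = (d \o p)%VF by apply/lfunP => x; rewrite comp_lfunE dE.
  by rewrite nuoutE -numapE // phi0 nuev0.
exists (nuin psi); apply: nu_ext => c cL; rewrite numapE // nuev_nuin.
  have /rhomP cS := cL.
  by have := psiE c cS; rewrite lfunE nuoutE.
exact: rlinear_comp (ses_rlinear_i ip).
Qed.

Lemma nu_ses_comp phi : numap p (numap i phi) = 0.
Proof.
rewrite numap_comp; last exact: ses_rlinear_p ip.
have -> : (p \o i)%VF = 0; last exact: numap0.
by apply/lfunP => x; rewrite comp_lfunE zero_lfunE (ses_comp ip).
Qed.

(** Since [Ext^1(W, A) = 0], restriction [Hom(P, A) -> Hom(K, A)] is surjective, so its dual is
    injective. *)
Lemma nu_ses_inj : E1 W (rreg A) -> forall phi, numap i phi = 0 -> phi = 0.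
Proof.
move=> EW phi phi0; apply: nu_ext => c cL; rewrite nuev0.
have [e eL eE] := E1_ext EW ip cL.
have -> : c = (e \o i)%VF by apply/lfunP => x; rewrite comp_lfunE eE.
by rewrite -numapE // phi0 nuev0.
Qed.

End NuSes.

Section Tau.
Variables (m : nat) (X : rmodule A).
Hypothesis prK : projective (iter m.+1 syz X).

Let K r := iter r syz X.
Let i r : 'Hom(K r.+1, cover (K r)) := syzygy_incl (K r).
Let p r : 'Hom(cover (K r), K r) := cover_map (K r).

Let ip r : ses (i r) (p r). Proof. exact: ses_cover. Qed.
Let iL r : rlinear (i r). Proof. exact: ses_rlinear_i (ip r). Qed.
Let pL r : rlinear (p r). Proof. exact: ses_rlinear_p (ip r). Qed.
Let prP r : projective (cover (K r)). Proof. exact: cover_projective. Qed.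

(** Maps from [Z] to [nu (K m.+1)] are functionals on [Hom(K m.+1, Z)]; those landing in the
    translate vanish on the maps that extend to [cover (K m)]. Hence [Hom(Z, tau X)] is dual to
    [Ext^(m+1)(X, Z)]. *)
Lemma hom_tau Z : ExtV m.+1 X Z <-> ExtV 0 Z (tau m.+1 X).
Proof.
have [j [jL j_inj jE]] := tau_translate m X.
split=> [EZ f fL | H].
  have gL := rlinear_comp jL fL.
  have [phi phiE] := functional_of_hom prK gL.
  have phi0 e : rlinear e -> phi (e \o i m)%VF = 0.
    move=> eL; have [r [z [c [cL eE]]]] := rank1_span (@prP m) eL.
    have -> : (e \o i m)%VF = \sum_a rank1 (z a) (c a \o i m)%VF.
      apply/lfunP => x; rewrite comp_lfunE eE !sum_lfunE.
      by apply: eq_bigr => a _; rewrite !rank1E comp_lfunE.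
    rewrite linear_sum big1 // => a _ /=.
    rewrite phiE; last exact: rlinear_comp (cL a) (@iL m).
    rewrite -(numapE (i m) _ (cL a)) comp_lfunE;
      have [_ ->] := jE (j (f (z a))).
      by rewrite nuev0.
    by exists (f (z a)).
  apply/lfunP => z; rewrite zero_lfunE; apply: j_inj; apply: nu_ext => c cL.
  rewrite -comp_lfunE -phiE // nuev0.
  have [e eL eE] := EZ _ (rank1_rlinear z cL).
  have -> : rank1 z c = (e \o i m)%VF.
    by apply/lfunP => x; rewrite eE comp_lfunE.
  exact: phi0.
move=> f fL.
pose S : {vspace 'Hom(K m.+1, Z)} :=
  (linfun (precomp (W := Z) (i m)) @: rhom (cover (K m)) Z)%VS.
have [fS | /functional_sep[phi phi0]] := boolP (f \in S).
  have /memv_imgP[e /rhomP eL fE] := fS; exists e => // x.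
  by rewrite fE lfunE /= comp_lfunE.
case/negP; have [g gL gE] := hom_of_functional phi.
have [||t tL tE] := lift_along_inj (f := g) jL j_inj => //.
  move=> z; apply/jE; apply: nu_ext => c cL.
  rewrite numapE // nuev0 gE; last exact: rlinear_comp cL (@iL m).
  rewrite rank1_precomp phi0 //; apply/memv_imgP; exists (rank1 z c).
    exact/rhomP/rank1_rlinear.
  by rewrite lfunE.
have [r [z [c [cL ->]]]] := rank1_span prK fL.
rewrite linear_sum big1 // => a _ /=.
by rewrite -gE // tE (H t tL) zero_lfunE linear0 nuev0.
Qed.

Hypothesis EXA : forall r, (r < m)%N -> E1 (K r) (rreg A).

(** By [tau_ses] and [nu_step_ses] these kernels are the cosyzygies of [tau m.+1 X] in its
    coresolution by [nu (K m.+1)], [nu (cover (K m))], and so on. *)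
Let kerG r : exists G, exists g : 'Hom(G, nu (cover (K r))),
  ses g (numap (p r)).
Proof.
apply: ses_kernel; first exact: numap_rlinear.
exact: nu_ses_surj (ip r).
Qed.

Lemma nu_step_ses r G G' (g : 'Hom(G, nu (cover (K r))))
    (g' : 'Hom(G', nu (cover (K r.+1)))) :
  (r < m)%N -> ses g (numap (p r)) -> ses g' (numap (p r.+1)) ->
  exists b : 'Hom(nu (cover (K r.+1)), G), ses g' b /\
    forall phi, g (b phi) = numap (i r \o p r.+1)%VF phi.
Proof.
move=> rm sg sg'.
have dL : rlinear (i r \o p r.+1)%VF by exact: rlinear_comp.
have [z|b bL bE] := ses_lift sg (numap_rlinear dL).
  by rewrite -numap_comp // (nu_ses_comp (ip r)).
exists b; split=> //; split=> //.
- exact: ses_rlinear_i sg'.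
- exact: ses_inj sg'.
- move=> y; have [phi phiE] := nu_ses_exact (ip r) (ses_comp sg y).
  have [phi' phi'E] := nu_ses_surj (ip r.+1) phi; exists phi'.
  apply: (ses_eq sg); rewrite -bE -numap_comp //.
  by rewrite -phi'E.
- move=> x; apply: (ses_inj sg).
  by rewrite -bE -numap_comp // (ses_comp sg') linear0.
move=> y by0; apply: (ses_exact sg').
apply: (nu_ses_inj (ip r) (EXA rm)); rewrite numap_comp // bE by0 linear0 //.
Qed.

Lemma tau_ses G (g : 'Hom(G, nu (cover (K m)))) : ses g (numap (p m)) ->
  exists j : 'Hom(tau m.+1 X, nu (K m.+1)), exists b : 'Hom(nu (K m.+1), G),
    ses j b /\ forall phi, g (b phi) = numap (i m) phi.
Proof.
move=> sg; have [j [jL j_inj jE]] := tau_translate m X.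
have [z|b bL bE] := ses_lift sg (numap_rlinear (@iL m)).
  exact: nu_ses_comp (ip m) z.
exists j, b; split=> //; split=> //.
- move=> y; have [phi phiE] := nu_ses_exact (ip m) (ses_comp sg y).
  by exists phi; apply: (ses_eq sg); rewrite -bE.
- move=> x; apply: (ses_inj sg); rewrite -bE; apply/jE; by exists x.
by move=> y by0; apply/jE; rewrite bE by0 linear0.
Qed.

(** Dimension shifting along the coresolution of the translate: [s] uses of [nu_step_ses] and one of
    [tau_ses] raise the degree by [s + 1]. *)
Lemma climb Z s t r G (g : 'Hom(G, nu (cover (K r)))) : (r + s)%N = m ->
  ses g (numap (p r)) -> E1 (iter t syz Z) G ->
  E1 (iter (s + t).+1 syz Z) (tau m.+1 X).
Proof.
elim: s t r G g => [|s IH] t r G g rs sg EG.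
  rewrite addn0 in rs; subst r; have [j [b [jb _]]] := tau_ses sg.
  exact/(E1_shift_iter _ _ jb (nu_injective prK)).
have [G' [g' sg']] := kerG r.+1.
have rm : (r < m)%N by rewrite -rs -[r in (r < _)%N]addn0 ltn_add2l.
have [b [gb _]] := nu_step_ses rm sg sg'.
rewrite addSnnS; apply: (IH _ r.+1 _ g') => //; first by rewrite addSnnS.
exact/(E1_shift_iter _ _ gb (nu_injective (@prP _))).
Qed.

Lemma ExtV_factored j Z : ExtV j X Z ->
  forall f : 'Hom(K j, Z), rlinear f -> proj_factored f.
Proof.
case: j => [|j] EZ f fL.
  rewrite (EZ f fL); exists (rzero A), 0, 0; split.
  - exact: rfree_projective.
  - exact: rlinear0.
  - exact: rlinear0.
  - by move=> x; rewrite !zero_lfunE.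
have [e eL eE] := EZ f fL; exists (cover (K j)), (i j), e; split=> //.
Qed.

(** By [nu_lift], every map from [Z] to the kernel [G] lifts to the injective that covers it, so
    [Ext^1(Z, G') = 0] for the next kernel [G']; [climb] carries this to the translate. *)
Lemma Ext_tau j Z : (j <= m)%N -> ExtV j X Z -> ExtV (m.+1 - j) Z (tau m.+1 X).
Proof.
move=> jm EZ; rewrite subSn // /=; have fac := ExtV_factored EZ.
have [G [g sg]] := kerG j.
have exd x : p j x = 0 -> exists y, x = i j y by exact: ses_exact (ip j) x.
move: jm; rewrite leq_eqVlt => /predU1P[jm|jm].
  (* For [j = m] the translate itself takes the place of the next kernel. *)
  rewrite jm subnn /=; rewrite jm in g sg fac exd *.
  have [t [b [tb bE]]] := tau_ses sg.
  apply: (E1_of_inj tb (nu_injective prK)) => h hL.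
  have [||h' h'L h'E] := nu_lift (g := (g \o h)%VF) (@prP m) (@iL m) (@pL m)
    (ses_surj (ip m)) exd fac.
  - exact: rlinear_comp (ses_rlinear_i sg) hL.
  - by move=> z; rewrite comp_lfunE (ses_comp sg).
  exists h' => // z; apply: (ses_eq sg); by rewrite bE h'E comp_lfunE.
have [G' [g' sg']] := kerG j.+1.
have [b [gb bE]] := nu_step_ses jm sg sg'.
have : E1 Z G'.
  apply: (E1_of_inj gb (nu_injective (@prP _))) => h hL.
  have [|x /exd[y ->]|||h' h'L h'E] := nu_lift (d := (i j \o p j.+1)%VF)
    (g := (g \o h)%VF) (@prP j) _ (@pL j) (ses_surj (ip j)) _ fac.
  - exact: rlinear_comp.
  - by have [y' ->] := ses_surj (ip j.+1) y; exists y'; rewrite comp_lfunE.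
  - exact: rlinear_comp (ses_rlinear_i sg) hL.
  - by move=> z; rewrite comp_lfunE (ses_comp sg).
  exists h' => // z; apply: (ses_eq sg); by rewrite bE h'E comp_lfunE.
move=> /(@climb Z (m - j.+1) 0 j.+1 _ _ (subnKC jm) sg').
by rewrite addn0 subnSK.
Qed.

End Tau.

End ExtTau.

(** * Modules with prescribed translate *)

Section Cotranslate.
Local Open Scope ring_scope.
Variables (k : fieldType) (A : falgType k).
Implicit Types E F K L M N P Q T U V W X Y Z I J G : rmodule A.

Local Notation syz := (@syzygy k A).

Lemma projective_retract P Q (q : 'Hom(P, Q)) (i : 'Hom(Q, P)) :
  projective P -> rlinear q -> rlinear i -> (forall x, q (i x) = x) ->
  projective Q.
Proof.
move=> prP qL iL qi M N g f gL fL /limg_fullP gS.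
have [h hL hE] := projective_lift prP gL (rlinear_comp fL qL) gS.
exists (h \o i)%VF; first exact: rlinear_comp.
by apply/lfunP => x; rewrite !comp_lfunE hE comp_lfunE qi.
Qed.

Lemma nu_faithful_eq F P (f g : 'Hom(F, P)) : projective P ->
  rlinear f -> rlinear g -> (forall phi, numap f phi = numap g phi) -> f = g.
Proof.
move=> prP fL gL fg; apply/eqP; rewrite eq_sym -subr_eq0; apply/eqP.
apply: nu_faithful prP (rlinearB gL fL) _ => phi.
by rewrite addrC -scaleN1r numapP fg scaleN1r addNr.
Qed.

(** [J] splits off some [nu (A^r)]; by full faithfulness the idempotent [i \o ret] comes from an
    idempotent [e] of [A^r], whose image is [P]. *)
Lemma injective_nu J : injective_mod J ->
  exists2 P, projective P & exists f : 'Hom(J, nu P), exists g : 'Hom(nu P, J),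
    [/\ rlinear f, rlinear g, forall x, g (f x) = x & forall y, f (g y) = y].
Proof.
move=> injJ; have [r [i iL i_inj]] := nu_embed J.
have [ret retL retE] := injective_extend injJ iL i_inj (@rlinear1 _ _ J).
have ri x : ret (i x) = x by rewrite -retE id_lfunE.
have prF := @rfree_projective _ A r.
have [e eL eE] := nu_full prF (rlinear_comp iL retL).
have [P [q [j [qL jL q_surj j_inj ejq]]]] := image_factor eL.
have ejq' : e = (j \o q)%VF by apply/lfunP => x; rewrite comp_lfunE ejq.
have ee : (e \o e)%VF = e.
  apply: (nu_faithful_eq prF) => // [|phi]; first exact: rlinear_comp.
  by rewrite -numap_comp // -!eE !comp_lfunE ri.
have qj x : q (j x) = x.
  have [y ->] := q_surj x; apply/eqP; rewrite -subr_eq0; apply/eqP/j_inj.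
  by rewrite linearB /= -!ejq -comp_lfunE ee subrr.
have prP := projective_retract prF qL jL qj.
exists P => //; exists (numap q \o i)%VF, (ret \o numap j)%VF; split.
- exact: rlinear_comp (numap_rlinear qL) iL.
- exact: rlinear_comp retL (numap_rlinear jL).
- move=> x; rewrite !comp_lfunE numap_comp // -ejq' -eE comp_lfunE.
  by rewrite !ri.
move=> y; rewrite !comp_lfunE -[i (ret _)]comp_lfunE eE ejq' -[RHS]numap_id.
rewrite (numap_comp _ _ qL) numap_comp; last first.
  by apply: rlinear_comp => //; exact: rlinear_comp.
by congr (numap _ _); apply/lfunP => x; rewrite !comp_lfunE id_lfunE !qj.
Qed.

Lemma kernel_exists M N (f : 'Hom(M, N)) : rlinear f ->
  exists K, exists2 i : 'Hom(K, M), rlinear i &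
    (forall x, i x = 0 -> x = 0) /\ forall y, f y = 0 <-> exists x, y = i x.
Proof.
move=> fL; have [U [q [j [qL jL q_surj j_inj fE]]]] := image_factor fL.
have [K [i iq]] := ses_kernel qL q_surj.
exists K, i; first exact: ses_rlinear_i iq.
split=> [|y]; first exact: ses_inj iq.
split=> [fy | [x ->]]; last by rewrite fE (ses_comp iq) linear0.
by apply/(ses_exact iq)/j_inj; rewrite -fE.
Qed.

Lemma E1_projective_iter s P L : projective P -> E1 (iter s syz P) L.
Proof.
move=> prP; elim: s L => [|s IH] L; first exact: projective_E1.
have [r [J [i [p ip]]]] := injective_ses L.
exact/(E1_shift_iter _ _ ip (@nu_rfree_injective _ _ r)).
Qed.

(* Pulling a coresolution [L -> nu F_0 -> ... -> nu F_m+1] back along the fully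
   faithful [nu] gives [F_0 -> ... -> F_m+1], whose cokernel is [Y]. *)
Lemma cotranslate m L :
  (forall Z, E1 (iter m.+1 syz Z) L) ->
  (forall s, (s < m)%N -> E1 (iter s syz (nu (rreg A))) L) ->
  exists Y, exists U, exists F, exists F', exists W,
  exists q : 'Hom(F, U), exists i : 'Hom(U, F'), exists p : 'Hom(F', W),
  exists j : 'Hom(L, nu F),
  [/\ projective F /\ projective F',
      [/\ rlinear q, forall y, exists x, y = q x, ses i p & resolves m Y W],
      [/\ rlinear j, forall x, j x = 0 -> x = 0
        & forall phi, numap (i \o q)%VF phi = 0 <-> exists x, phi = j x]
    & forall Z s, (s <= m)%N -> E1 (iter s syz Z) L -> ExtV (m - s) Y Z].
Proof.
elim: m L => [|m IH] L idL EL.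
  have [r [J [j [p0 jp0]]]] := injective_ses L.
  have injF := @nu_rfree_injective _ A r.
  have injJ : injective_mod J.
    by move=> Z; apply/(E1_shift_iter 0 Z jp0 injF)/idL.
  have [F' prF' [f [g [fL gL gf fg]]]] := injective_nu injJ.
  have prF := @rfree_projective _ A r.
  have [h hL hE] := nu_full prF' (rlinear_comp fL (ses_rlinear_p jp0)).
  have [U [q [i [qL iL q_surj i_inj hiq]]]] := image_factor hL.
  have [Y [p ip]] := ses_cokernel iL i_inj.
  have iqE : (i \o q)%VF = h by apply/lfunP => x; rewrite comp_lfunE hiq.
  exists Y, U, (rfree A r), F', Y, q, i, p, j; split=> //.
    split; [exact: ses_rlinear_i jp0|exact: ses_inj jp0|move=> phi].
    rewrite iqE -hE comp_lfunE; split=> [f0|[x ->]].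
      by apply: (ses_exact jp0); rewrite -[p0 phi]gf f0 linear0.
    by rewrite (ses_comp jp0) linear0.
  move=> Z s; rewrite leqn0 => /eqP -> /= EZ c cL.
  have cpL := rlinear_comp cL (ses_rlinear_p ip).
  (* With the zero module as third term, [nu_colift] shows that a map killed by [h] is zero. *)
  have [t tL _||e eL eE] := nu_colift (h := h) (h' := 0 : 'Hom(F', rzero A))
    prF prF' hL (@rlinear0 _ _ _ _) _ cpL.
  - have [u uL uE] := E1_lift EZ jp0 (rlinear_comp gL tL).
    by exists u => // z; rewrite -hE comp_lfunE uE comp_lfunE fg.
  - by move=> x; rewrite hiq comp_lfunE (ses_comp ip) linear0.
  apply/lfunP => y; have [x ->] := ses_surj ip y.
  by have := eE x; rewrite comp_lfunE !zero_lfunE linear0.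
have [r [L' [j [p0 jp0]]]] := injective_ses L.
have injF := @nu_rfree_injective _ A r; have prF0 := @rfree_projective _ A r.
have [Z|s sm|Y [U [F [F' [W [q [i [p [j' [[prF prF'] [qL q_surj ip
  YW]]]]]]]]]]] := IH L'.
- exact/(E1_shift_iter _ _ jp0 injF)/idL.
- by apply/(E1_shift_iter _ _ jp0 injF)/EL.
case=> j'L j'_inj j'E ExtY.
have iL := ses_rlinear_i ip; have iqL := rlinear_comp iL qL.
have [h hL hE] := nu_full prF (rlinear_comp j'L (ses_rlinear_p jp0)).
have iqh : ((i \o q) \o h)%VF = 0.
  apply: nu_faithful prF' (rlinear_comp iqL hL) _ => phi.
  rewrite -numap_comp // -hE comp_lfunE; apply/j'E; by exists (p0 phi).
have qh x : q (h x) = 0.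
  by apply: (ses_inj ip); have /lfunP/(_ x) := iqh;
    rewrite !comp_lfunE zero_lfunE.
have lift_h Z (g : 'Hom(Z, nu F)) : E1 Z L -> rlinear g ->
    (forall z, numap (i \o q)%VF (g z) = 0) ->
    exists2 g' : 'Hom(Z, nu (rfree A r)), rlinear g' & forall z, numap h (g' z)
      = g z.
  move=> EZ gL g0; have [z|t tL tE] := lift_along_inj j'L j'_inj gL.
    exact/j'E.
  have [u uL uE] := E1_lift EZ jp0 tL; exists u => // z.
  by rewrite -hE comp_lfunE uE tE.
(* The element [x] is seen as a map [A -> F]; its image under [nu] lifts along [numap h] because
   [Ext^1(nu A, L) = 0], and fullness of [nu] returns a preimage of [x]. *)
have exact_h x : q x = 0 -> exists y, x = h y.
  move=> qx0; pose xh : 'Hom(rreg A, F) := linfun (ract x : A -> F).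
  have xhE a : xh a = ract x a by rewrite lfunE.
  have xhL : rlinear xh by move=> a b; rewrite !xhE -ractM.
  have [||g gL gE] := lift_h _ (numap xh) (EL 0 (ltn0Sn m)).
  - exact: numap_rlinear.
  - move=> phi; rewrite numap_comp //.
    have -> : ((i \o q) \o xh)%VF = 0; last exact: numap0.
    apply/lfunP => a; rewrite !comp_lfunE xhE zero_lfunE qL qx0 ract0l.
    exact: linear0.
  have [y yL yE] := nu_full prF0 gL.
  have xhy : xh = (h \o y)%VF.
    apply: (nu_faithful_eq prF) => // [|phi]; first exact: rlinear_comp.
    by rewrite -numap_comp // -yE gE.
  exists (y 1); have := xhE 1; rewrite ract1 => <-.
  by rewrite xhy comp_lfunE.
have [U1 [q1 [i1 [q1L i1L q1_surj i1_inj hiq]]]] := image_factor hL.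
have iq1E : (i1 \o q1)%VF = h by apply/lfunP => x; rewrite comp_lfunE hiq.
have i1q : ses i1 q.
  split=> // [u|x /exact_h[y ->]]; last by exists (q1 y).
  by have [y ->] := q1_surj u; rewrite -hiq qh.
exists Y, U1, (rfree A r), F, U, q1, i1, q, j; split=> //.
- by split=> //; exists W, F', i, p.
- split; [exact: ses_rlinear_i jp0|exact: ses_inj jp0|move=> phi].
  rewrite iq1E -hE comp_lfunE; split=> [/j'_inj p00|[x ->]].
    exact: (ses_exact jp0).
  by rewrite (ses_comp jp0) linear0.
move=> Z [_ EZ|s sm EZ]; last first.
  by rewrite subSS; apply: ExtY => //; apply/(E1_shift_iter _ _ jp0 injF).
rewrite subn0; apply/(resolves_E1 Z YW)/(E1_of_proj ip prF') => c cL.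
have [t tL t0||e eL eE] := nu_colift (h := h) (h' := (i \o q)%VF) prF0 prF hL
  iqL
  _ (rlinear_comp cL qL).
- exact: lift_h.
- by move=> x; rewrite comp_lfunE qh linear0.
exists e => // u; have [x ->] := q_surj u.
by have := eE x; rewrite !comp_lfunE.
Qed.

Lemma retract_refl X : retract X X X.
Proof.
exists \1%VF, 0, \1%VF, 0; split; try exact: rlinear1; try exact: rlinear0.
by move=> x; rewrite !id_lfunE zero_lfunE addr0.
Qed.

Lemma retract_hom Z X N1 N2 : retract X N1 N2 ->
  ExtV 0 Z N1 -> ExtV 0 Z N2 -> ExtV 0 Z X.
Proof.
case=> [u1 [u2 [v1 [v2 [u1L u2L _ _ sum]]]]] H1 H2 f fL.
apply/lfunP => z; rewrite zero_lfunE -[f z]sum -!comp_lfunE -comp_lfunA.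
rewrite (H1 _ (rlinear_comp u1L fL)) comp_lfun0r zero_lfunE.
by rewrite -comp_lfunA (H2 _ (rlinear_comp u2L fL)) comp_lfun0r zero_lfunE
  addr0.
Qed.

(** The bound on the global dimension makes the syzygy [U] projective, so [q] splits and [L], the
    kernel of [numap (i \o q)], decomposes into the kernel [T] of [numap i] and an injective
    part. *)
Lemma cotranslate_tau m L : gldim_le A m.+1 ->
  (forall s, (s < m)%N -> E1 (iter s syz (nu (rreg A))) L) ->
  exists Y, exists T, exists J,
  [/\ injective_mod J, retract L T J,
      [/\ retract T (tau m.+1 Y) (tau m.+1 Y), retract (tau m.+1 Y) T T
        & retract T L L]
    & forall Z s, (s <= m)%N -> E1 (iter s syz Z) L -> ExtV (m - s) Y Z].
Proof.
move=> gl EL; have idL Z : E1 (iter m.+1 syz Z) L by exact: gldim_E1.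
have [Y [U [F [F' [W [q [i [p [j]]]]]]]]] := cotranslate idL EL.
case=> [[prF prF'] [qL q_surj ip YW] [jL j_inj jE] ExtY].
have iL := ses_rlinear_i ip.
have YU : resolves m.+1 Y U by exists W, F', i, p.
have prU : projective U.
  by apply: E1_projective => Z; apply/(resolves_E1 Z YU)/gldim_E1.
have [sec secL secE] := projective_lift prU qL (@rlinear1 _ _ U) q_surj.
have qsec x : q (sec x) = x by rewrite secE id_lfunE.
have [T [jT jTL [jT_inj jTE]]] := kernel_exists (numap_rlinear iL).
have j0 x : numap i (numap q (j x)) = 0.
  by rewrite numap_comp //; apply/jE; exists x.
have [||a aL aE] := lift_along_inj (f := (numap q \o j)%VF) jTL jT_inj.
- exact: rlinear_comp (numap_rlinear qL) jL.
- by move=> z; rewrite comp_lfunE; apply/jTE.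
have [||b bL bE] := lift_along_inj (f := (numap sec \o jT)%VF) jL j_inj.
- exact: rlinear_comp (numap_rlinear secL) jTL.
- move=> z; rewrite comp_lfunE; apply/jE; rewrite numap_comp;
    last exact: rlinear_comp.
  have -> : (i \o q \o sec = i)%VF by apply/lfunP => x;
    rewrite !comp_lfunE qsec.
  by apply/jTE; exists z.
(* [d] projects [F] to the kernel of [q]; [numap d] takes values in [L] and so supplies the
   retraction [v] for the injective part. *)
pose d : 'Hom(F, F) := (\1 - (sec \o q))%VF.
have dL : rlinear d by apply: rlinearB; [exact: rlinear1|exact: rlinear_comp].
have [||v vL vE] := lift_along_inj (f := numap d) jL j_inj.
- exact: numap_rlinear.
- move=> z; apply/jE; rewrite numap_comp; last exact: rlinear_comp.
  have -> : (i \o q \o d = 0)%VF; last exact: numap0.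
  apply/lfunP => x; rewrite zero_lfunE !comp_lfunE add_lfunE opp_lfunE id_lfunE.
  by rewrite comp_lfunE linearB /= qsec subrr linear0.
have trT : is_translate i T by exists jT.
have [cY tY] := (ses_cover (iter m syz Y), tau_translate m Y).
(* [W] and the standard syzygy are both [m]-th syzygies of [Y], hence stable retracts of each other;
   so [T] and [tau m.+1 Y] are retracts of each other's sums. *)
have rYW := stable_retract_resolves (resolves_std m Y) YW YW
  (retract_stable (retract_refl Y)).
have rWY := stable_retract_resolves YW (resolves_std m Y) (resolves_std m Y)
  (retract_stable (retract_refl Y)).
have prC := @cover_projective _ _ (iter m syz Y).
exists Y, T, (nu F); split=> //; first exact: nu_injective.
- exists a, j, b, v; split=> // x.
  apply: (hom_inj j_inj); rewrite linearD /= -bE -vE comp_lfunE -aE comp_lfunE.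
  rewrite numap_comp // -numapD.
  have -> : ((sec \o q) + d = \1)%VF by rewrite /d addrC subrK.
  exact: numap_id.
- split.
  + exact: (translate_retract ip cY cY prF' prC prC rWY trT tY tY).
  + exact: (translate_retract cY ip ip prC prF' prF' rYW tY trT trT).
  exists b, 0, a, 0; split=> // [||x]; try exact: rlinear0.
  rewrite !zero_lfunE addr0; apply: (hom_inj jT_inj).
  rewrite -aE comp_lfunE -bE comp_lfunE numap_comp //.
  have -> : (q \o sec = \1)%VF by apply/lfunP => y;
    rewrite comp_lfunE id_lfunE qsec.
  exact: numap_id.
Qed.

End Cotranslate.

(** * Subcategories *)

Section Subcategories.
Local Open Scope ring_scope.
Variables (k : fieldType) (A : falgType k).
Implicit Types E F K L M N P Q T U V W X Y Z I J G : rmodule A.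
Implicit Types C : rmodule A -> Prop.

Local Notation syz := (@syzygy k A).

(** With [K] the kernel of the retraction [v], [dsum N1 N2] is isomorphic to [dsum X K]. *)
Lemma subcategory_retract C X N1 N2 : subcategory C ->
  C N1 -> C N2 -> retract X N1 N2 -> C X.
Proof.
case=> [C_iso _ C_sum C_summand] CN1 CN2.
case=> [u1 [u2 [v1 [v2 [u1L u2L v1L v2L sum]]]]].
have [u uL uE] := pair_exists u1L u2L.
have [v vL vE] := copair_exists v1L v2L.
have vu x : v (u x) = x by rewrite vE uE /= sum.
have [|K [i iv]] := ses_kernel vL; first by move=> x; exists (u x).
have eL : rlinear (\1 - (u \o v))%VF.
  by apply: rlinearB; [exact: rlinear1 | exact: rlinear_comp].
have [z|w wL wE] := ses_lift iv eL.
  by rewrite add_lfunE opp_lfunE id_lfunE comp_lfunE linearB /= vu subrr.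
have [f fL fE] := pair_exists vL wL.
have [g gL gE] := copair_exists uL (ses_rlinear_i iv).
have iw n : i (w n) = n - u (v n).
  by rewrite -wE add_lfunE opp_lfunE id_lfunE comp_lfunE.
apply: (C_summand X K); apply: (C_iso (dsum N1 N2)); last exact: C_sum.
exists f => //; exists g => [n|[x y]]; first by rewrite gE fE /= iw addrC subrK.
have vg : v (u x + i y) = x by rewrite linearD /= vu (ses_comp iv) addr0.
rewrite fE gE /= vg; congr (_, _); apply: (ses_eq iv).
by rewrite iw vg addrC addKr.
Qed.

Lemma add_closure_subcategory C : subcategory (add_closure C).
Proof.
split=> [X Y|||]; [exact: add_iso|exact: add_zero|exact: add_dsum|exact:
  add_summand].
Qed.

Lemma add_closure_min S C X : subcategory C -> (forall Y, S Y -> C Y) ->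
  add_closure S X -> C X.
Proof.
case=> [C_iso C0 C_sum C_summand] SC;
  elim=> {X} [X /SC //|X Y XY _|//|X Y _ CX _ CY|X Y _].
- exact: C_iso.
- exact: C_sum.
- exact: C_summand.
Qed.

Lemma riso_retract X Y : riso X Y -> retract Y X X.
Proof.
case=> f fL [g fK gK].
have gL : linear g.
  by move=> a x y; apply: (can_inj fK); rewrite gK [RHS]linearP /= !gK.
exists (hom_of gL), 0, f, 0; split=> // [x a|||x]; try exact: rlinear0.
  by rewrite !hom_ofE; apply: (can_inj fK); rewrite fL !gK.
by rewrite hom_ofE gK !zero_lfunE addr0.
Qed.

Lemma zero_retract X N1 N2 : (forall x : X, x = 0) -> retract X N1 N2.
Proof.
move=> X0; exists 0, 0, 0, 0; split; try exact: rlinear0.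
by move=> x; rewrite [RHS]X0 [LHS]X0.
Qed.

Lemma dsum_retract X Y : retract (dsum X Y) X Y.
Proof.
have [l lL lE] := pair_exists (@rlinear1 _ _ X) (@rlinear0 _ _ X Y).
have [r rL rE] := pair_exists (@rlinear0 _ _ Y X) (@rlinear1 _ _ Y).
have [p pL pE] := copair_exists (@rlinear1 _ _ X) (@rlinear0 _ _ Y X).
have [q qL qE] := copair_exists (@rlinear0 _ _ X Y) (@rlinear1 _ _ Y).
exists p, q, l, r; split=> // - [x y].
rewrite pE qE lE rE /= !id_lfunE !zero_lfunE addr0 add0r.
by congr (_, _); rewrite ?addr0 ?add0r.
Qed.

Lemma summand_retract X Y : retract X (dsum X Y) (dsum X Y).
Proof.
have [l lL lE] := pair_exists (@rlinear1 _ _ X) (@rlinear0 _ _ X Y).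
have [p pL pE] := copair_exists (@rlinear1 _ _ X) (@rlinear0 _ _ Y X).
exists l, 0, p, 0; split=> // [||x]; try exact: rlinear0.
by rewrite pE lE /= id_lfunE !zero_lfunE !addr0 id_lfunE.
Qed.

Lemma retract_closed_subcategory C :
  C (rzero A) -> (forall X N1 N2, C N1 -> C N2 -> retract X N1 N2 -> C X) ->
  subcategory C.
Proof.
move=> C0 C_ret; split=> // [X Y XY CX|X Y CX CY|X Y CXY].
- exact: (C_ret _ _ _ CX CX (riso_retract XY)).
- exact: (C_ret _ _ _ CX CY (dsum_retract X Y)).
- exact: (C_ret _ _ _ CXY CXY (summand_retract X Y)).
Qed.

Lemma rzero_eq0 (x : rzero A) : x = 0.
Proof. by apply/ffunP => - []. Qed.

Lemma tau_projective m P : projective P -> forall x : tau m.+1 P, x = 0.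
Proof.
move=> prP x; have [j [_ j_inj jE]] := tau_translate m P.
apply: j_inj; apply: (nu_ses_inj (ses_cover (iter m syz P))).
  exact: E1_projective_iter.
by apply/jE; exists x.
Qed.

(** The translate preserves retracts. Properties of translates can thereby be checked on the
    generators of an add closure. *)
Lemma subcategory_tau C m : subcategory C ->
  subcategory (fun X => C (tau m.+1 X)).
Proof.
move=> sC; apply: retract_closed_subcategory => [|X N1 N2 C1 C2 /(@tau_retract
  _ _ m)].
  have [_ C0 _ _] := sC; apply: (subcategory_retract sC C0 C0).
  exact/zero_retract/tau_projective/rfree_projective.
exact: subcategory_retract.
Qed.

Lemma subcategory_tau_iter C m l : subcategory C ->
  subcategory (fun X => C (iter l (tau m.+1) X)).
Proof.
elim: l C => [|l IH] C sC //;
  exact: (IH (fun X => C (tau m.+1 X))) (subcategory_tau m sC).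
Qed.

Lemma E1_retract W X N1 N2 : retract X N1 N2 -> E1 W N1 -> E1 W N2 -> E1 W X.
Proof.
case=> [u1 [u2 [v1 [v2 [u1L u2L v1L v2L sum]]]]] E1N E2N c cL.
have [e1 e1L e1E] := E1N _ (rlinear_comp u1L cL).
have [e2 e2L e2E] := E2N _ (rlinear_comp u2L cL).
exists ((v1 \o e1) + (v2 \o e2))%VF; first by apply: rlinearD;
  exact: rlinear_comp.
by move=> x; rewrite add_lfunE !comp_lfunE -e1E -e2E !comp_lfunE sum.
Qed.

(** [Hom_A(A, A)] is [A] acting by left multiplication, so [c |-> c 1] and [x |-> amull x] relate
    [DA] to [nu A]. *)
Lemma dual_lreg_retract : retract (dual (lreg A)) (nu (rreg A)) (nu (rreg A)).
Proof.
pose ev (psi : dual (lreg A)) (x : A) : k := (psi : 'Hom(lreg A, k^o)) x.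
have evP a psi psi' x : ev (a *: psi + psi') x = a * ev psi x + ev psi' x.
  by rewrite /ev add_lfunE scale_lfunE.
have ev_linear psi a x y : ev psi (a *: x + y) = a * ev psi x + ev psi y.
  by rewrite /ev linearP.
have ev_act psi a x : ev (ract psi a) x = ev psi (a * x) by exact: dual_ractE.
have u1L psi : linear (fun c : 'Hom(rreg A, rreg A) => ev psi (c 1) : k^o).
  by move=> a c c'; rewrite add_lfunE scale_lfunE ev_linear.
have uL : linear (fun psi => nuin (hom_of (u1L psi)) : nu (rreg A)).
  by move=> a x y; apply: nu_ext => c cL;
    rewrite nuevP !nuev_nuin // !hom_ofE evP.
have amullP a (x y : A) : amull (a *: x + y) = a *: amull x + amull y.
  apply/lfunP => z; rewrite add_lfunE scale_lfunE !lfunE /=.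
  by rewrite mulrDl scalerAl.
have v1L (phi : nu (rreg A)) : linear (fun x : lreg A => nuev phi (amull x) :
  k^o).
  by move=> a x y; rewrite amullP nuev_linear.
have vL : linear (fun phi => hom_of (v1L phi) : dual (lreg A)).
  by move=> a x y; apply/lfunP => z;
    rewrite add_lfunE scale_lfunE !hom_ofE nuevP.
have aL x : rlinear (M := rreg A) (N := rreg A) (amull x) by exact:
  amull_rlinear.
exists (hom_of uL), 0, (hom_of vL), 0; split=> // [psi a||phi a||psi].
- rewrite !hom_ofE; apply: nu_ext => c cL; rewrite nuev_ract // !nuev_nuin //.
    by rewrite 2!hom_ofE ev_act; congr (ev psi _); rewrite comp_lfunE lfunE.
  exact: rlinear_comp (aL a) cL.
- exact: rlinear0.
- rewrite 2!hom_ofE; apply/lfunP => x.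
  rewrite dual_ractE 2!hom_ofE nuev_ract //; congr (nuev phi _).
  by apply/lfunP => y; rewrite comp_lfunE !lfunE /= mulrA.
- exact: rlinear0.
rewrite !hom_ofE zero_lfunE addr0; apply/lfunP => x.
by rewrite hom_ofE nuev_nuin // hom_ofE lfunE /= mulr1.
Qed.

Lemma rreg_projective : projective (rreg A).
Proof.
move=> M N g f gL fL /limg_fullP gS.
have [x xE] := gS (f 1); pose h : 'Hom(rreg A, M) := linfun (ract x : A -> M).
have hE a : h a = ract x a by rewrite lfunE.
exists h => [a b|]; first by rewrite !hE -ractM.
apply/lfunP => a; rewrite comp_lfunE hE gL -xE -fL /=.
by rewrite mul1r.
Qed.

Lemma dual_injective : injective_mod (dual (lreg A)).
Proof.
move=> Z; have injA := nu_injective rreg_projective.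
exact: (E1_retract dual_lreg_retract).
Qed.

(** The maps [x |-> (b |-> lam i (x b))] to [DA] are jointly injective, so [I] embeds in a power of
    [DA] and splits off. *)
Lemma injective_subcategory C I : subcategory C -> C (dual (lreg A)) ->
  injective_mod I -> C I.
Proof.
move=> sC CD injI; pose r := \dim {:I}.
(* Coordinates are extended by zero beyond the dimension, so that the induction on [s] runs over all
   natural numbers. *)
pose lam (i : nat) (x : I) : k := if insub i is Some i' then coord (vbasis
  {:I}) i' x else 0.
have lamP i a x y : lam i (a *: x + y) = a * lam i x + lam i y.
  by rewrite /lam; case: insub => [i'|]; rewrite ?linearP // mulr0 addr0.
have emb s : exists N, exists2 u : 'Hom(I, N), C N /\ rlinear u &
    forall x, u x = 0 -> forall i, (i < s)%N -> lam i x = 0.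
  elim: s => [|s [N [u [CN uL] u0]]].
    by exists (rzero A), 0 => //; split; [case: sC | exact: rlinear0].
  have f1L x : linear (fun b : lreg A => lam s (ract x (b : A)) : k^o).
    by move=> a b c; rewrite ract_linearr lamP.
  have fL : linear (fun x => hom_of (f1L x) : dual (lreg A)).
    move=> a x y; apply/lfunP => b; rewrite add_lfunE scale_lfunE !hom_ofE.
    by rewrite ract_linearl lamP.
  have frL : rlinear (hom_of fL).
    by move=> x a; apply/lfunP => b; rewrite dual_ractE !hom_ofE ractM.
  have [v vL vE] := pair_exists frL uL.
  exists (dsum (dual (lreg A)) N), v; first by split=> //; case: sC => _ _ + _;
    apply.
  move=> x; rewrite vE => - [f0 ux0] i; rewrite ltnS leq_eqVlt.
  case/predU1P => [->|]; last exact: u0.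
  have /lfunP/(_ 1) := f0; rewrite !hom_ofE zero_lfunE.
  by rewrite ract1.
have [N [u [CN uL] u0]] := emb r.
have [|e eL eE] := injective_extend injI uL _ (@rlinear1 _ _ I).
  move=> x /u0 x0; rewrite (coord_vbasis (memvf x)) big1 // => i _.
  by have := x0 i (ltn_ord i); rewrite /lam valK => ->; rewrite scale0r.
apply: (subcategory_retract sC CN CN); exists u, 0, e, 0.
split=> // [||x]; try exact: rlinear0.
by rewrite -eE id_lfunE zero_lfunE addr0.
Qed.

Lemma hom_subcategory Z : subcategory (fun X => ExtV 0 X Z).
Proof.
apply: retract_closed_subcategory => [f _|X N1 N2 H1 H2].
  by apply/lfunP => x; rewrite (rzero_eq0 x) !linear0.
case=> [u1 [u2 [v1 [v2 [u1L u2L v1L v2L sum]]]]] f fL.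
apply/lfunP => x; rewrite zero_lfunE -[x]sum linearD /=.
have /lfunP/(_ (u1 x)) := H1 _ (rlinear_comp fL v1L).
have /lfunP/(_ (u2 x)) := H2 _ (rlinear_comp fL v2L).
by rewrite !comp_lfunE !zero_lfunE => -> ->; rewrite addr0.
Qed.

End Subcategories.

Arguments rreg_projective {k} A.

(** * Cluster tilting subcategories *)

Section ClusterTilting.
Local Open Scope ring_scope.
Variables (k : fieldType) (A : falgType k).
Implicit Types E F K L M N P Q T U V W X Y Z I J G : rmodule A.

Local Notation syz := (@syzygy k A).

(** The identity of [M] has this form, the zero module has the empty sum, and by [retr] the form
    passes to retracts. *)
Lemma add_obj_identity M X : add_obj M X ->
  exists2 s : seq ('Hom(X, M) * 'Hom(M, X)),
    forall f, f \in s -> rlinear f.1 /\ rlinear f.2 &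
    forall x, x = \sum_(f <- s) f.2 (f.1 x).
Proof.
have retr N1 N2 (s1 : seq ('Hom(N1, M) * 'Hom(M, N1)))
    (s2 : seq ('Hom(N2, M) * 'Hom(M, N2))) Y :
    (forall f, f \in s1 -> rlinear f.1 /\ rlinear f.2) ->
    (forall x, x = \sum_(f <- s1) f.2 (f.1 x)) ->
    (forall f, f \in s2 -> rlinear f.1 /\ rlinear f.2) ->
    (forall x, x = \sum_(f <- s2) f.2 (f.1 x)) ->
    retract Y N1 N2 ->
    exists2 s : seq ('Hom(Y, M) * 'Hom(M, Y)),
      forall f, f \in s -> rlinear f.1 /\ rlinear f.2 &
      forall x, x = \sum_(f <- s) f.2 (f.1 x).
  move=> s1L s1E s2L s2E [u1 [u2 [v1 [v2 [u1L u2L v1L v2L sum]]]]].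
  exists ([seq ((f.1 \o u1)%VF, (v1 \o f.2)%VF) | f <- s1] ++
          [seq ((f.1 \o u2)%VF, (v2 \o f.2)%VF) | f <- s2]).
    move=> f; rewrite mem_cat => /orP[] /mapP[g gs ->] /=.
      by have [g1 g2] := s1L g gs; split; exact: rlinear_comp.
    by have [g1 g2] := s2L g gs; split; exact: rlinear_comp.
  move=> x; rewrite big_cat !big_map /= -{1}[x]sum {1}[u1 x]s1E {1}[u2 x]s2E.
  rewrite !linear_sum; congr (_ + _); apply: eq_bigr => f _.
    by rewrite /= !comp_lfunE.
  by rewrite /= !comp_lfunE.
elim=> {X} [_ ->|X Y XY _ [s sL sE]||X Y _ [s sL sE] _ [t tL tE]|X Y _ [s sL
  sE]].
- exists [:: (\1%VF, \1%VF)] => [f|x]; last by rewrite big_seq1 /= !id_lfunE.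
  by rewrite inE => /eqP -> /=; split; exact: rlinear1.
- exact: (retr _ _ _ _ _ sL sE sL sE (riso_retract XY)).
- by exists [::] => // x; rewrite big_nil; exact: rzero_eq0.
- exact: (retr _ _ _ _ _ sL sE tL tE (dsum_retract X Y)).
exact: (retr _ _ _ _ _ sL sE sL sE (summand_retract X Y)).
Qed.

(** The identity of [X], as a sum of maps through [M], is inserted three times. Thus [a \o d] and
    [c \o b] are endomorphisms of [M], and for two different modules [d] after [c] is a morphism
    between them, to which orthogonality applies. *)
Lemma add_obj_nonzero M X (x : X) : add_obj M X -> x != 0 ->
  exists a : 'Hom(X, M), exists b : 'Hom(M, X), exists c : 'Hom(X, M),
  exists d : 'Hom(M, X), exists w : M,
  [/\ rlinear c, rlinear d & a (d (c (b w))) != 0].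
Proof.
move=> /add_obj_identity[s sL sE].
have pick y : y != 0 -> exists2 f, f \in s & f.2 (f.1 y) != 0.
  move=> y0; apply/hasP; apply: contraR y0 => /hasPn H.
  rewrite [y]sE big_seq big1 // => f fs.
  by have := H f fs; rewrite negbK => /eqP.
move=> /pick[p _ /pick[q qs /pick[r _ rz]]].
have [q1 q2] := sL q qs.
exists r.1, p.2, q.1, q.2, (p.1 x); split=> //.
by apply: contraNneq rz => ->; rewrite linear0.
Qed.

(* If all [X_i] were nonzero, the endomorphisms [a_i \o d_i] of [M] factoring
   through them would be linearly independent, being triangular with respect
   to composition with [c_j \o b_j]. *)
Lemma add_obj_orthogonal_zero M (X : nat -> rmodule A) :
  (forall i, (i <= \dim {:'Hom(M, M)})%N -> add_obj M (X i)) ->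
  (forall i j, (i < j <= \dim {:'Hom(M, M)})%N -> ExtV 0 (X j) (X i)) ->
  exists2 i, (i <= \dim {:'Hom(M, M)})%N & forall x : X i, x = 0.
Proof.
set l := \dim _ => XM orth.
have [/existsP[i /eqP Xi0]|/existsPn Xn0] :=
    boolP [exists i : 'I_l.+1, \dim {:X i} == 0%N].
  exists i => [|x]; first by rewrite -ltnS ltn_ord.
  apply/eqP; rewrite -memv0; move/eqP: Xi0; rewrite dimv_eq0 => /eqP <-.
  exact: memvf.
have ex (i : 'I_l.+1) : exists fgw : 'Hom(M, M) * 'Hom(M, M) * M,
    fgw.1.1 (fgw.1.2 fgw.2) != 0 /\
    exists a : 'Hom(X i, M), exists b : 'Hom(M, X i), exists c : 'Hom(X i, M),
    exists d : 'Hom(M, X i),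
    [/\ rlinear c, rlinear d, fgw.1.1 = (a \o d)%VF & fgw.1.2 = (c \o b)%VF].
  have x0 : vpick {:X i} != 0 by rewrite vpick0 -dimv_eq0.
  have iM : add_obj M (X i) by apply: XM; rewrite -ltnS ltn_ord.
  have [a [b [c [d [w [cL dL nz]]]]]] := add_obj_nonzero iM x0.
  exists ((a \o d)%VF, (c \o b)%VF, w); split; first by rewrite /= !comp_lfunE.
  by exists a, b, c, d.
have [fgw fgwP] := fin_all_exists ex.
pose f i := (fgw i).1.1; pose g i := (fgw i).1.2; pose w i := (fgw i).2.
have nz i : f i (g i (w i)) != 0 by have [] := fgwP i.
have fg0 (i j : 'I_l.+1) y : (i < j)%N -> f i (g j y) = 0.
  move=> ij; have [_ [a [_ [_ [d [_ dL fE _]]]]]] := fgwP i.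
  have [_ [_ [b [c [_ [cL _ _ gE]]]]]] := fgwP j.
  rewrite /f /g fE gE !comp_lfunE.
  have ijl : (i < j <= l)%N by rewrite ij -ltnS ltn_ord.
  have /lfunP/(_ (b y)) := orth _ _ ijl _ (rlinear_comp dL cL).
  by rewrite comp_lfunE zero_lfunE => ->; rewrite linear0.
have fr : free [tuple f i | i < l.+1].
  apply/freeP => c c0; have c0' : \sum_(i < l.+1) c i *: f i = 0.
    by rewrite -{}[RHS]c0; apply: eq_bigr => i _;
      rewrite (nth_map i) ?size_enum_ord // nth_ord_enum.
  move=> i0; apply/eqP; apply: contraT => ci0.
  (* For the largest [j] with nonzero coefficient the relation is evaluated at [g j (w j)], where
     the smaller indices drop out by [fg0]. *)
  case: (arg_maxnP (P := fun i : 'I_l.+1 => c i != 0) (fun i => i : nat) ci0)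
    => j cj jmax.
  have /lfunP/(_ (g j (w j))) := c0';
    rewrite zero_lfunE sum_lfunE (bigD1 j) //=.
  rewrite big1 ?addr0 => [|i ij].
    by rewrite scale_lfunE => /eqP;
      rewrite scaler_eq0 (negPf cj) (negPf (nz j)).
  rewrite scale_lfunE; have [ci|/jmax ij'] := eqVneq (c i) 0;
    first by rewrite ci scale0r.
  have : (i <= j)%N by []; rewrite leq_eqVlt => /predU1P[{}ij'|{}ij'];
    last by rewrite fg0 // scaler0.
  by rewrite (val_inj ij') eqxx in ij.
have := dimvS (subvf <<[tuple f i | i < l.+1]>>%VS).
by rewrite (eqP (fr : _ == _)) size_tuple ltnn.
Qed.

(** * Cluster tilting in global dimension at most n = m + 1 *)

Section BoundedGlobalDimension.
Variable m : nat.
Hypothesis gl : gldim_le A m.+1.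

Local Notation taun := (tau m.+1).

Lemma gldim_syzygy X : projective (iter m.+1 syz X).
Proof. by apply: E1_projective => L; exact: gldim_E1. Qed.

Section OneSubcategory.
Variable C : rmodule A -> Prop.
Hypothesis ctC : cluster_tilting m.+1 C.

Let sC : subcategory C. Proof. by case: ctC. Qed.

(** The index [r] stands for degree [r + 1], so [r < m] covers the degrees strictly between 0 and
    [m + 1]. *)
Lemma ct_E1 X Y r : C X -> C Y -> (r < m)%N -> E1 (iter r syz X) Y.
Proof.
by case: ctC => _ _ H _ /H CX CY rm; apply/Ext_vanishesE/CX.
Qed.

Lemma ct_memr X : (forall Z r, C Z -> (r < m)%N -> E1 (iter r syz Z) X) -> C X.
Proof.
case: ctC => _ _ _ H HX; apply/H => Z CZ [//|r] rm.
exact/Ext_vanishesE/HX.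
Qed.

Lemma ct_meml X : (forall Z r, C Z -> (r < m)%N -> E1 (iter r syz X) Z) -> C X.
Proof.
case: ctC => _ _ H _ HX; apply/H => Z CZ [//|r] rm.
exact/Ext_vanishesE/HX.
Qed.

Lemma ct_injective I : injective_mod I -> C I.
Proof. by move=> injI; apply: ct_memr => Z r _ _; exact: injI. Qed.

Lemma ct_projective P : projective P -> C P.
Proof. by move=> prP; apply: ct_meml => Z r _ _; exact: E1_projective_iter. Qed.

Lemma ct_Ext_tau X j Z : C X -> (j <= m)%N -> ExtV j X Z ->
  ExtV (m.+1 - j) Z (taun X).
Proof.
move=> CX; apply: Ext_tau; first exact: gldim_syzygy.
by move=> r; apply: ct_E1 => //; exact/ct_projective/(rreg_projective A).
Qed.

(** [Ext^(m-r)(X, Z) = 0] gives [Ext^(r+1)(Z, taun X) = 0], and both degrees lie strictly between 0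
    and [m + 1]. *)
Lemma ct_tau X : C X -> C (taun X).
Proof.
move=> CX; apply: ct_memr => Z r CZ rm.
have : ExtV (m - r) X Z.
  by rewrite -(subnSK rm); apply: ct_E1 => //;
    rewrite ltn_subrL (leq_ltn_trans _ rm).
move/(ct_Ext_tau CX (leq_subr _ _)).
by rewrite subSn ?leq_subr // subKn // ltnW.
Qed.

Lemma ct_tau_iter X i : C X -> C (iter i taun X).
Proof. by move=> CX; elim: i => //= i; exact: ct_tau. Qed.

(** The case [j = 0] of [ct_Ext_tau] gives [Ext^(m+1)(Z, taun X) = 0], which [hom_tau] for [Z] turns
    into a vanishing of Hom. *)
Lemma ct_orthogonal X Z : C X -> ExtV 0 X Z -> ExtV 0 (taun X) (taun Z).
Proof.
move=> CX H; apply: (proj1 (hom_tau (@gldim_syzygy Z) _)).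
by rewrite -[m.+1]subn0; exact: ct_Ext_tau.
Qed.

Lemma injective_orthogonal I Z : injective_mod I -> ExtV 0 I (taun Z).
Proof. by move=> injI; apply: (proj1 (hom_tau (@gldim_syzygy Z) _));
  exact: injI. Qed.

Lemma orbit_ct X : tau_orbit m.+1 X -> C X.
Proof.
apply: add_closure_min => // Y [i ->].
exact/ct_tau_iter/ct_injective/dual_injective.
Qed.

(** [L] is related to [taun Y] through all subcategories [C'] containing [DA], so that the orbit and
    its preimages under powers of [taun] can be inserted. *)
Lemma ct_cotranslate L : C L -> exists Y, [/\ C Y,
  forall C', subcategory C' -> C' (dual (lreg A)) -> C' (taun Y) -> C' L,
  forall Z, ExtV 0 Z L -> ExtV 0 Z (taun Y)
  & forall Z, ExtV 0 L (taun Z) -> ExtV 0 Y Z].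
Proof.
move=> CL; have Cnu : C (nu (rreg A)).
  exact/ct_injective/nu_injective/(rreg_projective A).
have [s sm|Y [T [J [injJ LTJ [Ttau tauT TL] ExtY]]]] := cotranslate_tau (L :=
  L) gl.
  exact: ct_E1.
exists Y; split.
- apply: ct_meml => Z r CZ rm.
  have := ExtY Z (m - r.+1)%N (leq_subr _ _); rewrite subKn //.
  by apply; apply: ct_E1; rewrite // ltn_subrL (leq_ltn_trans _ rm).
- move=> C' sC' C'D C'tau.
  apply: (subcategory_retract sC' _ (injective_subcategory sC' C'D injJ) LTJ).
  exact: subcategory_retract Ttau.
- move=> Z HL; have HT := retract_hom TL HL HL.
  exact: (retract_hom tauT HT HT).
move=> Z /(proj2 (hom_tau (@gldim_syzygy Z) _)) EZ.
by have := ExtY Z m (leqnn m) EZ; rewrite subnn.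
Qed.

Lemma ct_chain l L : C L -> exists f : nat -> rmodule A, [/\ f 0 = L,
  forall i, C (f i) &
  forall i, (i < l)%N -> [/\
    forall C', subcategory C' -> C' (dual (lreg A)) -> C' (taun (f i.+1)) ->
      C' (f i),
    forall Z, ExtV 0 Z (f i) -> ExtV 0 Z (taun (f i.+1))
    & forall Z, ExtV 0 (f i) (taun Z) -> ExtV 0 (f i.+1) Z]].
Proof.
elim: l L => [|l IH] L CL; first by exists (fun=> L).
have [Y [CY Y1 Y2 Y3]] := ct_cotranslate CL.
have [f [f0 fC fE]] := IH Y CY.
exists (fun i => if i is i'.+1 then f i' else L); split=> // [[|i] //|[|i] il].
  by rewrite f0.
exact: fE.
Qed.

(** Stripping off [taun] by [ct_orthogonal] leaves maps from the injective [DA] to a translate. *)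
Lemma hom_orbit l i Z : C Z -> (i < l)%N ->
  ExtV 0 (iter i taun (dual (lreg A))) (iter l taun Z).
Proof.
move=> CZ; elim: i l => [|i IH] [|l] //= il.
  exact: (@injective_orthogonal _ (iter l taun Z) (@dual_injective _ _)).
apply: ct_orthogonal; last exact: IH.
exact/ct_tau_iter/ct_injective/dual_injective.
Qed.

(** For [taun^i DA] the bound is [i + 1], and sums take the larger bound. Uniformity in [Z] is what
    [ct_orbit] uses. *)
Lemma hom_tau_orbit X : tau_orbit m.+1 X ->
  exists l0, forall l Z, (l0 <= l)%N -> C Z -> ExtV 0 X (iter l taun Z).
Proof.
elim=> {X} [_ [i ->]|X Y XY _ [l H]||X Y _ [l H] _ [l' H']|X Y _ [l H]].
- by exists i.+1 => l Z il CZ; exact: hom_orbit.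
- exists l => l' Z ll CZ; have [iso _ _ _] := hom_subcategory (iter l' taun Z).
  exact: iso XY (H _ _ ll CZ).
- by exists 0 => l Z _ _; have [_ H _ _] := hom_subcategory (iter l taun Z).
- exists (maxn l l') => l'' Z; rewrite geq_max => /andP[ll ll'] CZ.
  have [_ _ sum _] := hom_subcategory (iter l'' taun Z).
  by apply: sum; [exact: H | exact: H'].
exists l => l' Z ll CZ; have [_ _ _ summ] := hom_subcategory (iter l' taun Z).
exact: summ (H _ _ ll CZ).
Qed.

End OneSubcategory.

Lemma orbit_subcategory : subcategory (tau_orbit (A := A) m.+1).
Proof. exact: add_closure_subcategory. Qed.

Lemma orbit_tau X : tau_orbit m.+1 X -> tau_orbit m.+1 (taun X).
Proof.
apply: (add_closure_min (subcategory_tau m orbit_subcategory)) => Y [i ->].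
by apply: add_gen; exists i.+1.
Qed.

Lemma orbit_dual i : tau_orbit m.+1 (iter i taun (dual (lreg A))).
Proof. by apply: add_gen; exists i. Qed.

(** * The case C = add M *)

Section FiniteType.
Variable M : rmodule A.
Hypothesis ctM : cluster_tilting m.+1 (add_obj M).

Lemma rreg_orbit : tau_orbit m.+1 (rreg A).
Proof.
set l := \dim {:'Hom(M, M)}.
have CA : add_obj M (rreg A) := ct_projective ctM (rreg_projective A).
have [f [f0 fC fE]] := ct_chain ctM l CA.
(* Since [taun A = 0], [Hom(f j, A) = 0] for [j > 0]; and [Hom(f j, f i) = 0] passes to
   [Hom(f j, taun (f i.+1)) = 0], then to [Hom(f j.+1, f i.+1) = 0]. *)
have orth i j : (i < j <= l)%N -> ExtV 0 (f j) (f i).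
  elim: i j => [|i IH] [|j] // /andP[ij jl]; have [_ _ fj] := fE j jl;
    apply: fj.
    rewrite f0 => h _; apply/lfunP => x; rewrite zero_lfunE.
    exact: tau_projective (rreg_projective A) _.
  rewrite ltnS in ij; have [_ fi _] := fE i (ltn_trans ij jl).
  by apply: (fi); apply: IH; rewrite ij ltnW.
have [|i il fi0] := add_obj_orthogonal_zero _ orth; first by move=> i _;
  exact: fC.
have fi : tau_orbit m.+1 (f i).
  have [_ O0 _ _] := orbit_subcategory.
  exact: (subcategory_retract orbit_subcategory O0 O0 (zero_retract _ _ fi0)).
(* From the vanishing term one descends the chain to [f 0 = A], passing from [f i.+1] to its
   translate and then to [f i]. *)
rewrite -f0; elim: i il {fi0} fi => // i IH il fi1; apply: IH;
  first exact: ltnW.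
have [H _ _] := fE i il; apply: H => //; first exact: orbit_subcategory.
  exact: (orbit_dual 0).
exact: orbit_tau.
Qed.

Lemma ct_orbit X : add_obj M X -> tau_orbit m.+1 X.
Proof.
have [l Hl] := hom_tau_orbit ctM rreg_orbit.
(* An element [w] is a morphism from [A], which lies in the orbit, so one [l] makes [taun^l Z]
   vanish for all [Z]. *)
have tau0 Z : add_obj M Z -> forall w : iter l taun Z, w = 0.
  move=> CZ w; pose h : 'Hom(rreg A, iter l taun Z) := linfun (ract w : A -> _).
  have hE a : h a = ract w a by rewrite lfunE.
  have hL : rlinear h by move=> a b; rewrite !hE -ractM.
  by rewrite -(ract1 w) -hE (Hl l Z (leqnn l) CZ h hL) zero_lfunE.
have : forall Z, add_obj M Z -> tau_orbit m.+1 (iter l taun Z).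
  have [_ O0 _ _] := orbit_subcategory => Z CZ.
  apply: (subcategory_retract orbit_subcategory O0 O0).
  exact/zero_retract/tau0.
(* Descent from [j + 1] to [j]: [ct_cotranslate] is applied with the preimage of the orbit under
   [taun^j]. *)
elim: (l) X => [|j IH] X H CX; first exact: H.
apply: IH CX => Z CZ; have [Y [CY Y1 _ _]] := ct_cotranslate ctM CZ.
apply: (Y1 (fun W => tau_orbit m.+1 (iter j taun W))).
- exact/subcategory_tau_iter/orbit_subcategory.
- exact: orbit_dual.
by rewrite -iterSr; exact: H.
Qed.

End FiniteType.

End BoundedGlobalDimension.

Lemma cluster_tilting_iff n (C C' : rmodule A -> Prop) :
  (forall X, C X <-> C' X) -> cluster_tilting n C -> cluster_tilting n C'.
Proof.
move=> CC' [[C1 C2 C3 C4] [Cl Cr] CL CR]; split.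
- split=> [X Y XY /CC' CX||X Y /CC' CX /CC' CY|X Y /CC' CXY]; apply/CC' => //.
  + exact: C1 XY CX.
  + exact: C3.
  + exact: C4 CXY.
- split=> X.
    have [Y [f [CY fL H]]] := Cl X; exists Y, f; split=> //; first exact/CC'.
    by move=> Z g /CC'; exact: H.
  have [Y [f [CY fL H]]] := Cr X; exists Y, f; split=> //; first exact/CC'.
  by move=> Z g /CC'; exact: H.
- move=> X; split=> [/CC'/CL H Y /CC'|H]; first exact: H.
  by apply/CC'/CL => Y /CC'; exact: H.
move=> X; split=> [/CC'/CR H Y /CC'|H]; first exact: H.
by apply/CC'/CR => Y /CC'; exact: H.
Qed.

End ClusterTilting.

Theorem theorem1p6 (k : fieldType) (A : falgType k) (n : nat) (M : rmodule A)
    (n_ge1 : (1 <= n)%N)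
    (gldimA : gldim_le A n)
    (ctM : cluster_tilting n (add_obj M)) :
  (forall X : rmodule A, tau_orbit n X <-> add_obj M X) /\
  (cluster_tilting n (tau_orbit (A := A) n) /\
   forall C : rmodule A -> Prop, cluster_tilting n C ->
     forall X : rmodule A, C X <-> tau_orbit n X).
Proof.
case: n n_ge1 gldimA ctM => // m _ gl ctM.
have orbitE X : tau_orbit m.+1 X <-> add_obj M X.
  by split; [exact: orbit_ct | exact: ct_orbit].
split=> //; split=> [|C ctC X].
  by apply: cluster_tilting_iff ctM => X; apply: iff_sym.
split=> [CX|]; last exact: orbit_ct.
(* [C] contains the orbit, which is [add M]; so the Ext groups from [add M] to [X] vanish, and [X]
   lies in [add M]. *)
have [_ _ _ H] := ctM; apply/orbitE/H => Y /orbitE/(orbit_ct gl ctC) CY.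
by have [_ _ _ HC] := ctC; move/HC: CX; apply.
Qed.
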